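(* Let $\mathcal U$ be a full rank upper cluster algebra (of geometric type, with coefficient semifield $\mathrm{Trop}(Z_1,\ldots,Z_m)$) with initial seed $t_0$. Then the following statements are equivalent. (i) $\mathcal U$ is factorial. (ii) Every initial cluster variable $A_{k;t_0}$ ($k=1,\ldots,n$) is prime in $\mathcal U$. (iii) Every initial cluster variable $A_{k;t_0}$ satisfies $(A_{k;t_0}\mid\mid M\cdot L)_v=(A_{k;t_0}\mid\mid M)_v+(A_{k;t_0}\mid\mid L)_v$ for all non-zero elements $M,L\in\mathcal U$. (iv) Every exchange binomial $P_{k;t_0}$ of $t_0$ ($k=1,\ldots,n$) is irreducible in the polynomial ring $\mathbb K[Z_1,\ldots,Z_m][A_{1;t_0},\ldots,\widehat{A_{k;t_0}},\ldots,A_{n;t_0}]$ (where the hat means that the variable is omitted).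
   Context: Throughout, $\mathbb K$ is a factorial domain (UFD) of characteristic $0$. A semifield $(\mathbb P,\oplus,\cdot)$ is an abelian multiplicative group with a commutative, associative operation $\oplus$ over which multiplication distributes; $\mathbb{KP}$ is its group ring over $\mathbb K$, and $\mathcal F$ is the field of rational functions in $n$ independent variables with coefficients in $\mathbb{KP}$. An integer $n\times n$ matrix $B$ is skew-symmetrizable if $SB$ is skew-symmetric for some integer diagonal matrix $S$ with positive diagonal entries. A (labeled) $\mathscr A$-seed over $\mathbb P$ is a triple $(B,X,A)$ with $B=(b_{ij})$ an $n\times n$ skew-symmetrizable integer matrix, $X=(X_1,\ldots,X_n)\in\mathbb P^n$, and $A=(A_1,\ldots,A_n)$ a free generating set of $\mathcal F$ over $\mathbb{KP}$. Its $k$-th exchange binomial is $P_k=\frac{X_k}{1\oplus X_k}\prod_{b_{jk}>0}A_j^{b_{jk}}+\frac{1}{1\oplus X_k}\prod_{b_{jk}<0}A_j^{-b_{jk}}$ (denoted $P_{k;t}$ for a seed $t$). The mutation $\mu_k(B,X,A)=(B',X',A')$ is: $b'_{ij}=-b_{ij}$ if $i=k$ or $j=k$, else $b'_{ij}=b_{ij}+\mathrm{sgn}(b_{ik})\max(b_{ik}b_{kj},0)$; $X'_k=X_k^{-1}$ and $X'_i=X_iX_k^{\max(b_{ki},0)}(1\oplus X_k)^{-b_{ki}}$ for $i\ne k$; $A'_i=A_i$ for $i\neq k$ and $A'_k=A_k^{-1}P_k$. Let $\mathbb T_n$ be the $n$-regular tree with edges labeled $1,\ldots,n$ so that edges at each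 vertex have distinct labels. An $\mathscr A$-seed pattern assigns to each vertex $t$ a seed $(B_t,X_t,A_t)$, $B_t=(b^t_{ij})$, $X_t=(X_{1;t},\ldots,X_{n;t})$, $A_t=(A_{1;t},\ldots,A_{n;t})$, such that seeds at vertices joined by an edge labeled $k$ are related by $\mu_k$. A vertex and its seed are denoted by the same letter; one vertex $t_0$ is chosen as initial. The upper cluster algebra is $\mathcal U=\bigcap_{t}\mathcal L(t)$ with $\mathcal L(t)=\mathbb{KP}[A_{1;t}^{\pm1},\ldots,A_{n;t}^{\pm1}]$. The $A_{k;t}$ are the cluster variables (they lie in $\mathcal U$). Standing assumption: no exchange binomial of $\mathcal U$ is invertible in $\mathbb{KP}$. Geometric type: $\mathbb P=\mathrm{Trop}(Z_1,\ldots,Z_m)$, the free abelian group on $Z_1,\ldots,Z_m$ with $\prod Z_i^{a_i}\oplus\prod Z_i^{b_i}=\prod Z_i^{\min(a_i,b_i)}$. Writing $X_{k;t}=\prod_i Z_i^{c_{ik}^t}$, $C_t=(c_{ij}^t)_{m\times n}$, the extended exchange matrix is the $(n+m)\times n$ matrix $\widetilde B_t=\begin{pmatrix}B_t\\C_t\end{pmatrix}$. $\mathcal U$ is full rank if it is of geometric type and $\widetilde B_{t_0}$ has full rank $n$ (then every $\widetilde B_t$ has). In geometric type each exchange binomial of $t$ is a polynomial in the $Z_i$ and the $A_{j;t}$, $j\ne k$. Valuation pairing: for a cluster variable $A_{k;t}$ and $M\in\mathcal U$, $(A_{k;t}\mid\mid M)_v:=\max\{s\in\mathbb N\mid M/A_{k;t}^s\in\mathcal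 U\}\in\mathbb N\cup\{\infty\}$. *)

(* Defs.v *)
From HB Require Import structures.
From mathcomp Require Import all_boot all_order all_algebra.
From mathcomp Require Import fraction mpoly.
From Stdlib Require Import ClassicalEpsilon.

Set Implicit Arguments.
Unset Strict Implicit.
Unset Printing Implicit Defensive.

Import Order.TTheory GRing.Theory Num.Theory.
Local Open Scope ring_scope.

(* Divisibility inside a subring S of an integral domain R, given as a
   predicate; units, divisors, primes and irreducibles are those of S, not
   those of R. *)
Section Factoriality.
Variables (R : idomainType) (S : R -> Prop).

Definition unit_in (x : R) : Prop := S x /\ exists2 y, S y & x * y = 1.

Definition divides_in (x y : R) : Prop := exists2 z, S z & y = x * z.

Definition prime_in (x : R) : Prop :=
  [/\ S x, x <> 0, ~ unit_in x
    & forall y z, S y -> S z ->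
        divides_in x (y * z) -> divides_in x y \/ divides_in x z].

Definition irreducible_in (x : R) : Prop :=
  [/\ S x, x <> 0, ~ unit_in x
    & forall y z, S y -> S z -> x = y * z -> unit_in y \/ unit_in z].

Definition associated_in (x y : R) : Prop := exists2 u, unit_in u & y = x * u.

Definition factorial_in : Prop :=
  (forall x, S x -> x <> 0 -> ~ unit_in x ->
     exists2 s : seq R,
       (forall y, y \in s -> irreducible_in y) & x = \prod_(y <- s) y)
  /\
  (forall s1 s2 : seq R,
     (forall y, y \in s1 -> irreducible_in y) ->
     (forall y, y \in s2 -> irreducible_in y) ->
     \prod_(y <- s1) y = \prod_(y <- s2) y ->
     exists2 s : seq R, perm_eq s s2 & List.Forall2 associated_in s1 s).

End Factoriality.

Definition factorial_domain (R : idomainType) : Prop :=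
  factorial_in (fun _ : R => True).

(* The subring generated by a set G of elements. *)
Inductive subring_gen (R : pzRingType) (G : R -> Prop) : R -> Prop :=
| subring_gen_in x : G x -> subring_gen G x
| subring_gen1 : subring_gen G 1
| subring_genB x y : subring_gen G x -> subring_gen G y -> subring_gen G (x - y)
| subring_genM x y : subring_gen G x -> subring_gen G y -> subring_gen G (x * y).

(* N with infinity: None stands for infinity. *)
Definition natinf := option nat.

Definition addni (a b : natinf) : natinf :=
  if (a, b) is (Some i, Some j) then Some (i + j)%N else None.

(* The maximum of a non-empty set of naturals, infinity if it is unbounded. *)
Definition max_natinf (E : nat -> Prop) : natinf :=
  match excluded_middle_informative
          (exists s, E s /\ forall s', E s' -> (s' <= s)%N) with
  | left ex_max => Some (proj1_sig (constructive_indefinite_description _ ex_max))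
  | right _ => None
  end.

(* (x || M)_v relative to the subring S of the field F. *)
Definition val_pairing (F : fieldType) (S : F -> Prop) (x M : F) : natinf :=
  max_natinf (fun s => S (M / x ^+ s)).

(* The tropical semifield Trop(Z_1, ..., Z_m): the monomial \prod_i Z_i ^ (c i)
   is represented by its exponent vector c, so that the group law is written
   additively (product c + d, inverse - c, power c *~ e, neutral element 0). *)
Definition trop (m : nat) := 'rV[int]_m.

Definition trop_oplus (m : nat) (c d : trop m) : trop m :=
  \row_i Num.min (c 0 i) (d 0 i).

Section ClusterAlgebra.
Variables (K : idomainType) (m n : nat).

(* Since Frac(K[Z^{+-1}][x]) = Frac(K[Z][x]), this is the field of rational
   functions in n variables with coefficients in the group ring
   KP = K[Z^{+-1}] of Trop(Z_1, ..., Z_m). *)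
Definition ambient := {fraction {mpoly {mpoly K[m]}[n]}}.

Definition scalar (c : K) : ambient := tofrac (c%:MP%:MP).

Definition coefvar (i : 'I_m) : ambient := tofrac ('X_i)%:MP.

Definition trop_mon (c : trop m) : ambient := \prod_(i < m) coefvar i ^ c 0 i.

Definition KP : ambient -> Prop :=
  subring_gen (fun f => (exists c, f = scalar c) \/ (exists c, f = trop_mon c)).

Definition skew_symmetrizable (B : 'M[int]_n) : Prop :=
  exists2 d : 'rV[int]_n, (forall i, 0 < d 0 i)
    & (diag_mx d *m B)^T = - (diag_mx d *m B).

Definition KP_poly (p : {mpoly ambient[n]}) : Prop := forall e, KP p@_e.

Definition free_generating (A : 'I_n -> ambient) : Prop :=
  (forall p, KP_poly p -> p.@[A] = 0 -> p = 0) /\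
  (forall f, exists p q, [/\ KP_poly p, KP_poly q, q.@[A] <> 0
                           & f = p.@[A] / q.@[A]]).

Record preseed := Preseed {
  exmx : 'M[int]_n;
  coefs : {ffun 'I_n -> trop m};
  cluster : {ffun 'I_n -> ambient}
}.

Definition is_seed (t : preseed) : Prop :=
  skew_symmetrizable (exmx t) /\ free_generating (cluster t).

Definition exchange_binomial (t : preseed) (k : 'I_n) : ambient :=
  let B := exmx t in let X := coefs t in let A := cluster t in
  trop_mon (X k - trop_oplus 0 (X k)) * \prod_(j | 0 < B j k) A j ^ B j k
  + trop_mon (- trop_oplus 0 (X k)) * \prod_(j | B j k < 0) A j ^ (- B j k).

Definition mutation (k : 'I_n) (t : preseed) : preseed :=
  let B := exmx t in let X := coefs t in let A := cluster t in
  Preseed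
    (\matrix_(i, j)
       if (i == k) || (j == k) then - B i j
       else B i j + Num.sg (B i k) * Num.max (B i k * B k j) 0)
    [ffun i => if i == k then - X k
               else X i + X k *~ Num.max (B k i) 0
                        + trop_oplus 0 (X k) *~ (- B k i)]
    [ffun i => if i == k then (A k)^-1 * exchange_binomial t k else A i].

(* The n-regular tree T_n with labeled edges: a vertex is the sequence of edge
   labels read along the path from it to a fixed base vertex; such sequences
   are exactly those without two equal consecutive labels. *)
Record tree_vertex := TreeVertex {
  tree_word : seq 'I_n;
  tree_wordP : sorted (fun i j => i != j) tree_word
}.

Definition tree_edge (k : 'I_n) (t t' : tree_vertex) : Prop :=
  tree_word t' = k :: tree_word t \/ tree_word t = k :: tree_word t'.

Definition seed_pattern (Sigma : tree_vertex -> preseed) : Prop :=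
  (forall t, is_seed (Sigma t)) /\
  (forall k t t', tree_edge k t t' -> Sigma t' = mutation k (Sigma t)).

Definition laurent (t : preseed) : ambient -> Prop :=
  subring_gen (fun f =>
    [\/ KP f, exists i, f = cluster t i | exists i, f = (cluster t i)^-1]).

Definition upper_cluster_algebra (Sigma : tree_vertex -> preseed)
  (f : ambient) : Prop := forall t, laurent (Sigma t) f.

Definition coefmx (t : preseed) : 'M[int]_(m, n) := \matrix_(i, k) coefs t k 0 i.

Definition extended_exmx (t : preseed) : 'M[int]_(n + m, n) :=
  col_mx (exmx t) (coefmx t).

Definition full_rank (t : preseed) : Prop :=
  \rank (map_mx (intr : int -> rat) (extended_exmx t)) = n.

(* K[Z_1, ..., Z_m][A_j, j != k], as a subring of the ambient field. *)
Definition poly_omit (t : preseed) (k : 'I_n) : ambient -> Prop :=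
  subring_gen (fun f =>
    [\/ exists c, f = scalar c, exists i, f = coefvar i
      | exists2 j, j != k & f = cluster t j]).

End ClusterAlgebra.

(* Main.v *)
Require Import Defs.
From mathcomp Require Import all_boot all_order all_algebra.
From mathcomp Require Import fraction mpoly.
From mathcomp Require Import ring zify.
From Stdlib Require Import Classical ClassicalEpsilon.
Import Order.TTheory GRing.Theory Num.Theory.
Local Open Scope ring_scope.

Set Implicit Arguments.
Unset Strict Implicit.
Unset Printing Implicit Defensive.

(**
  Write [A_k'] for the cluster variable obtained from [A_k] by mutating [t0] in
  direction [k], so that [A_k A_k' = P_k], and let [t_k] be the mutated seed.

  Starfish: [U] is the intersection of [L(t0)] and of all the [L(t_k)].  This
  amounts to [L(s) /\ L(mu_2 mu_1 s) <= L(mu_2 s)].  In [L(mu_2 s)] every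
  cluster variable of [s] becomes a unit times a power of [u = 1 + yhat_2], and
  every one of [mu_2 mu_1 s] becomes a unit times an element [1 + h], where [h]
  has positive weight for a grading in which [u] has weight [0]; elements of
  these two kinds are coprime.  If [b_12 <> 0] the grading is by the exponent of
  the new second variable; if [b_12 = 0] it exists because the columns of the
  extended exchange matrix are independent.

  Consequently [U] contains the cluster of [t0], and [A_k] divides [y] in [U] iff
  [P_k] divides [y] in [L(t_k)], a factorial ring (Gauss' lemma and localization)
  in which [P_k] is not a unit.  So the valuations are finite, they are additive
  iff [A_k] is prime, and the primality of [A_k] is that of [P_k].  Units of
  [L(t0)] being monomials, every [A_k] is irreducible in [U]; conversely
  Nagata's argument lifts the factoriality of [L(t0) = U[1/A_1, ..., 1/A_n]] to
  [U] when all the [A_k] are prime.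
*)

(** * Factorization in a subring of an integral domain *)

(** Lying in [L(t)] and in the Laurent rings of all neighbours of [t] is a condition that can be
    carried across one edge of the tree. If [s] is the new vertex and [mu_1 s] the old one, then
    [L(s)] and [L(mu_2 mu_1 s)] are known to contain the element and [L(mu_2 s)] is sought, whence
    the shape of the inclusion.

    Coprimality is not obtained by factoring binomials. The element [1 + h] becomes invertible, by a
    geometric series, once the ring is completed along the grading; as [u] is homogeneous of weight
    0, the series can be cut off at a finite weight and still yields an exact quotient.

    The obstacle is the case [b_12 = 0]: if columns 1 and 2 were proportional, the two binomials
    could share a factor. Independence gives a functional that kills column 2 and is positive on
    column 1; hence independence has to be transported to every vertex.

    Coefficient and cluster variables are treated alike as [m + n] indeterminates, every [L(t)]
    being a polynomial ring over [K] localized at all its variables. They are told apart only in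
    [U], where the [Z_i] are invertible and the [A_k] are not. *)

Definition subring (R : pzRingType) (S : R -> Prop) : Prop :=
  [/\ S 1, forall x y, S x -> S y -> S (x - y)
    & forall x y, S x -> S y -> S (x * y)].

(** Required of all non-zero elements, this amounts to factoriality, but it passes to products,
    divisors, polynomial rings and localizations without any comparison of two factorizations. *)
Definition prime_factorable (R : idomainType) (S : R -> Prop) (x : R) : Prop :=
  exists u s, [/\ unit_in S u, forall p, p \in s -> prime_in S p
                & x = u * \prod_(p <- s) p].

Section Subring.
Variables (R : pzRingType) (S : R -> Prop).
Hypothesis subS : subring S.

Lemma subring1 : S 1. Proof. by case: subS. Qed.
Lemma subringB x y : S x -> S y -> S (x - y). Proof. by case: subS => _ h _; apply: h. Qed.
Lemma subringM x y : S x -> S y -> S (x * y). Proof. by case: subS => _ _; apply. Qed.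
Lemma subring0 : S 0. Proof. by rewrite -(subrr 1); apply: subringB; apply: subring1. Qed.
Lemma subringN x : S x -> S (- x).
Proof. by move=> Sx; rewrite -sub0r; apply: subringB => //; apply: subring0. Qed.
Lemma subringD x y : S x -> S y -> S (x + y).
Proof. by move=> Sx Sy; rewrite -[y]opprK; apply: subringB => //; apply: subringN. Qed.
Lemma subringX x k : S x -> S (x ^+ k).
Proof.
move=> Sx; elim: k => [|k IHk]; first by rewrite expr0; apply: subring1.
by rewrite exprS; apply: subringM.
Qed.
Lemma subring_sum (I : Type) (r : seq I) (Q : pred I) (F : I -> R) :
  (forall i, Q i -> S (F i)) -> S (\sum_(i <- r | Q i) F i).
Proof. by move=> SF; apply: big_ind => //; [apply: subring0 | apply: subringD]. Qed.
Lemma subring_prod (I : Type) (r : seq I) (Q : pred I) (F : I -> R) :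
  (forall i, Q i -> S (F i)) -> S (\prod_(i <- r | Q i) F i).
Proof. by move=> SF; apply: big_ind => //; [apply: subring1 | apply: subringM]. Qed.
End Subring.

Lemma subring_genP (R : pzRingType) (G : R -> Prop) : subring (subring_gen G).
Proof. by split; [apply: subring_gen1 | apply: subring_genB | apply: subring_genM]. Qed.

Lemma subring_gen_min (R : pzRingType) (G S : R -> Prop) :
  subring S -> (forall x, G x -> S x) -> forall x, subring_gen G x -> S x.
Proof.
move=> subS GS x; elim=> {x} [x /GS //||x y _ ? _ ?|x y _ ? _ ?].
- exact: subring1.
- exact: subringB.
- exact: subringM.
Qed.

Section Factoring.
Variables (R : idomainType) (S : R -> Prop).
Hypothesis subS : subring S.
Implicit Types (x y z u v p q : R) (s : seq R).

Let S1 := subring1 subS.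
Let SM := subringM subS.

Lemma unit_in_sub u : unit_in S u -> S u. Proof. by case. Qed.
Lemma unit_in1 : unit_in S 1.
Proof. by split=> //; exists 1; rewrite ?mulr1. Qed.

Lemma unit_in_neq0 u : unit_in S u -> u <> 0.
Proof. by case=> _ [v _ uv1 u0]; move: uv1 => /eqP; rewrite u0 mul0r eq_sym oner_eq0. Qed.

Lemma unit_in_inv u : unit_in S u -> exists2 v, unit_in S v & u * v = 1.
Proof. by case=> Su [v Sv uv]; exists v => //; split=> //; exists u; rewrite // mulrC. Qed.

Lemma unit_inM u v : unit_in S u -> unit_in S v -> unit_in S (u * v).
Proof.
move=> [Su [u' Su' uu']] [Sv [v' Sv' vv']]; split; first exact: SM.
by exists (u' * v'); [exact: SM | rewrite mulrACA uu' vv' mulr1].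
Qed.

Lemma unit_inMl x y : S x -> S y -> unit_in S (x * y) -> unit_in S x.
Proof.
move=> Sx Sy [_ [z Sz xyz]]; split=> //; exists (y * z); first exact: SM.
by rewrite mulrA.
Qed.

Lemma unit_inMr x y : S x -> S y -> unit_in S (x * y) -> unit_in S y.
Proof. by move=> Sx Sy; rewrite mulrC; apply: unit_inMl. Qed.

Lemma divides_in_trans x y z :
  divides_in S x y -> divides_in S y z -> divides_in S x z.
Proof. by case=> a Sa -> [b Sb ->]; exists (a * b); rewrite ?mulrA //; apply: SM. Qed.

Lemma divides_in_mulr x y z : S z -> divides_in S x y -> divides_in S x (y * z).
Proof. by move=> Sz [a Sa ->]; exists (a * z); rewrite ?mulrA //; apply: SM. Qed.

Lemma divides_in_unit x u y :
  unit_in S u -> divides_in S x (u * y) -> divides_in S x y.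
Proof.
case=> Su [v Sv uv] [a Sa e]; exists (a * v); first exact: SM.
by rewrite mulrA -e mulrAC uv mul1r.
Qed.

Lemma divides_in_mem x s :
  (forall y, y \in s -> S y) -> x \in s -> divides_in S x (\prod_(y <- s) y).
Proof.
move=> Ss xs; rewrite (big_rem x) //=; exists (\prod_(y <- rem x s) y) => //.
by rewrite big_seq; apply: subring_prod => // y /mem_rem; apply: Ss.
Qed.

Lemma Sprod s : (forall y, y \in s -> S y) -> S (\prod_(y <- s) y).
Proof. by move=> Ss; rewrite big_seq; apply: subring_prod. Qed.

Lemma prime_in_prod p s : prime_in S p -> (forall y, y \in s -> S y) ->
  divides_in S p (\prod_(y <- s) y) -> exists2 y, y \in s & divides_in S p y.
Proof.
move=> pp; elim: s => [_|y s IHs Ss].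
  by rewrite big_nil => -[z Sz pz]; case: pp => Sp _ [] //; split=> //; exists z.
have Ss' z : z \in s -> S z by move=> zs; apply: Ss; rewrite in_cons zs orbT.
rewrite big_cons; case: (pp) => _ _ _ h /h[||?|].
- by apply: Ss; rewrite mem_head.
- exact: Sprod.
- by exists y; rewrite ?mem_head.
- by case/(IHs Ss') => z zs pz; exists z; rewrite // in_cons zs orbT.
Qed.

Lemma prime_in_exp p x k : prime_in S p -> S x ->
  divides_in S p (x ^+ k) -> divides_in S p x /\ (0 < k)%N.
Proof.
move=> pp Sx; elim: k => [|k IHk].
  by rewrite expr0 => -[z Sz pz]; case: pp => Sp _ [] //; split=> //; exists z.
by rewrite exprS; case: (pp) => _ _ _ h /h[] //; [exact: subringX | case/IHk].
Qed.

Lemma prime_in_unit_mul p u : prime_in S p -> unit_in S u -> prime_in S (p * u).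
Proof.
case=> Sp p0 pN ph uu; have Su := unit_in_sub uu; split.
- exact: SM.
- move/eqP; rewrite mulf_eq0 => /orP[/eqP //|/eqP]; exact: unit_in_neq0.
- by move/(unit_inMl Sp Su).
have [v uv uv1] := unit_in_inv uu; have Sv := unit_in_sub uv.
have tr y : divides_in S p y -> divides_in S (p * u) y.
  case=> a Sa ->; exists (v * a); first exact: SM.
  by rewrite mulrA -(mulrA p) uv1 mulr1.
move=> y z Sy Sz [a Sa e]; have : divides_in S p (y * z).
  by rewrite e -mulrA; exists (u * a) => //; apply: SM.
by case/(ph _ _ Sy Sz) => /tr; [left|right].
Qed.

Lemma prime_irreducible p : prime_in S p -> irreducible_in S p.
Proof.
case=> Sp p0 pN ph; split=> // y z Sy Sz e.
have key a b : S a -> S b -> p = a * b -> divides_in S p a -> unit_in S b.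
  move=> Sa Sb ep [c Sc ea]; split=> //; exists c => //.
  have a0 : a != 0 by apply/eqP => a0; apply: p0; rewrite ep a0 mul0r.
  by apply: (mulfI a0); rewrite mulr1 mulrA -ep -ea.
case: (ph y z Sy Sz) => [|d|d]; first by exists 1; rewrite ?mulr1.
  by right; apply: key d.
by left; apply: (key z y) => //; rewrite mulrC.
Qed.

(** Each prime of [s] divides [x] or [y] and is cancelled on that side. The count of primes makes
    the induction of [poly_prime_factorable] terminate. *)
Lemma prime_factor_mul x y u s : S x -> S y -> unit_in S u ->
  (forall p, p \in s -> prime_in S p) -> x * y = u * \prod_(p <- s) p ->
  exists v s1 w s2,
    [/\ unit_in S v, unit_in S w, {subset s1 <= s}, {subset s2 <= s}
      & [/\ x = v * \prod_(p <- s1) p, y = w * \prod_(p <- s2) p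
          & size s = (size s1 + size s2)%N]].
Proof.
elim: s x y => [|p s IHs] x y Sx Sy uu ps e.
  rewrite big_nil mulr1 in e; exists x, [::], y, [::].
  split=> //; first by apply: (unit_inMl Sx Sy); rewrite e.
    by apply: (unit_inMr Sx Sy); rewrite e.
  by rewrite !big_nil !mulr1.
have pp := ps p (mem_head _ _); have [Sp /eqP p0 _ ph] := pp.
have ps' q : q \in s -> prime_in S q by move=> qs; apply: ps; rewrite in_cons qs orbT.
have Ss' : S (\prod_(q <- s) q) by apply: Sprod => q /ps' [].
have subcons t : {subset t <= s} -> {subset t <= p :: s}.
  by move=> ts q /ts qs; rewrite in_cons qs orbT.
have subcons2 t : {subset t <= s} -> {subset p :: t <= p :: s}.
  by move=> ts q; rewrite !in_cons => /orP[-> //|/ts ->]; rewrite orbT.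
rewrite big_cons in e; case: (ph x y Sx Sy).
- by rewrite e mulrCA; exists (u * \prod_(q <- s) q) => //; apply: SM => //; case: uu.
- case=> x' Sx' ex; have [||//|//||v [s1 [w [s2 [? ? ? ? [e1 e2 e3]]]]]] := IHs x' y.
  + by [].
  + by [].
  + by apply: (mulfI p0); rewrite mulrA -ex e mulrCA.
  exists v, (p :: s1), w, s2; split=> //; [exact: subcons2 | exact: subcons |].
  by rewrite big_cons ex e1 /= e3 mulrCA.
- case=> y' Sy' ey; have [||//|//||v [s1 [w [s2 [? ? ? ? [e1 e2 e3]]]]]] := IHs x y'.
  + by [].
  + by [].
  + by apply: (mulfI p0); rewrite mulrCA -ey e mulrCA.
  exists v, s1, w, (p :: s2); split=> //; [exact: subcons | exact: subcons2 |].
  by rewrite big_cons ey e2 /= e3 mulrCA addnS.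
Qed.

Lemma prime_factorable_divisor x y : S x -> S y ->
  prime_factorable S (x * y) -> prime_factorable S x.
Proof.
move=> Sx Sy [u [s [uu ps e]]].
have [v [s1 [w [s2 [uv _ sub _ [ex _ _]]]]]] := prime_factor_mul Sx Sy uu ps e.
by exists v, s1; split=> // p /sub /ps.
Qed.

Lemma prime_factorableM x y :
  prime_factorable S x -> prime_factorable S y -> prime_factorable S (x * y).
Proof.
case=> u [s [uu ps ->]] [v [t [uv pt ->]]]; exists (u * v), (s ++ t); split.
- exact: unit_inM.
- by move=> p; rewrite mem_cat => /orP[/ps|/pt].
- by rewrite big_cat mulrACA.
Qed.

Lemma prime_factorable_prime p : prime_in S p -> prime_factorable S p.
Proof.
move=> pp; exists 1, [:: p]; split; [exact: unit_in1 | | by rewrite mul1r big_seq1].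
by move=> q; rewrite inE => /eqP ->.
Qed.

Lemma prime_factorable_unit u : unit_in S u -> prime_factorable S u.
Proof. by move=> uu; exists u, [::]; split; rewrite // big_nil mulr1. Qed.

(** Cancelling the primes of [x] one at a time from [p ^+ k * y] costs at most one factor [p] each,
    and once they are exhausted no factor [p] can remain, since [p] is not a unit. This is the
    source of the finiteness of valuations. *)
Lemma prime_factorable_bound p x : S p -> ~ unit_in S p ->
  prime_factorable S x -> exists k, ~ divides_in S (p ^+ k) x.
Proof.
move=> Sp pN [u [s [uu ps ->]]]; exists (size s).+1 => -[y Sy e].
suff : ((size s).+1 <= size s)%N by rewrite ltnn.
move: (size s).+1 e => k; elim: s k y Sy ps => [|q s IHs] k y Sy ps e.
  case: k e => // k; rewrite big_nil mulr1 exprS -mulrA => e; case: pN.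
  by apply: (unit_inMl Sp (SM (subringX subS k Sp) Sy)); rewrite -e.
have pq := ps q (mem_head _ _); have [Sq /eqP q0 _ qh] := pq.
have ps' r : r \in s -> prime_in S r by move=> rs; apply: ps; rewrite in_cons rs orbT.
have Ss' : S (\prod_(q <- s) q) by apply: Sprod => r /ps' [].
rewrite big_cons mulrCA in e.
have : divides_in S q (p ^+ k * y).
  by rewrite -e; exists (u * \prod_(q <- s) q) => //; apply: SM => //; case: uu.
case/qh => //; first exact: subringX.
- case/(prime_in_exp pq Sp) => -[p' Sp' ep]; case: k e => // k e _.
  apply: (IHs k (p' * y)) => //; first exact: SM.
  apply: (mulfI q0); rewrite e exprS {1}ep; ring.
- case=> y' Sy' ey; apply: leqW; apply: (IHs k y') => //.
  by apply: (mulfI q0); rewrite e ey; ring.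
Qed.

Lemma irreducible_prime x : prime_factorable S x -> irreducible_in S x -> prime_in S x.
Proof.
case=> u [[|p s] [uu ps e]] [Sx x0 xN xh].
  by case: xN; rewrite e big_nil mulr1.
have pp := ps p (mem_head _ _); have [Sp _ pN _] := pp.
have Ss' : S (u * \prod_(q <- s) q).
  apply: SM; first by case: uu.
  by apply: Sprod => r rs; case: (ps r); rewrite // in_cons rs orbT.
rewrite big_cons mulrCA in e; rewrite e.
by case: (xh _ _ Sp Ss' e) => // ?; apply: prime_in_unit_mul.
Qed.

Lemma factorial_irreducible_prime x :
  factorial_in S -> irreducible_in S x -> prime_in S x.
Proof.
case=> ex uniq irrx; have [Sx x0 xN xh] := irrx; split=> // y z Sy Sz [w Sw e].
have [->|/eqP y0] := eqVneq y 0.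
  by left; exists 0; rewrite ?mulr0 //; apply: subring0.
have [->|/eqP z0] := eqVneq z 0.
  by right; exists 0; rewrite ?mulr0 //; apply: subring0.
have dvdx : divides_in S x (y * z) by rewrite e; exists w.
have [uy|yN] := classic (unit_in S y); first by right; apply: divides_in_unit dvdx.
have [uz|zN] := classic (unit_in S z).
  by left; rewrite mulrC in dvdx; apply: divides_in_unit dvdx.
have [s1 irr1 e1] := ex y Sy y0 yN; have [s2 irr2 e2] := ex z Sz z0 zN.
have irr12 t : t \in s1 ++ s2 -> irreducible_in S t.
  by rewrite mem_cat => /orP[/irr1|/irr2].
(* [factorial_in] compares bare products of irreducibles, so a unit cofactor [w] has to be absorbed
   into [x]; otherwise [x' = x] and [s3] factors [w]. *)
have [x' [s3 [irrx' dx irr3 e3]]] : exists x' s3, [/\ irreducible_in S x',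
    divides_in S x x', forall t, t \in s3 -> irreducible_in S t
    & x' * \prod_(t <- s3) t = y * z].
  have [uw|wN] := classic (unit_in S w).
    exists (x * w), [::]; split=> //.
    - split; [exact: SM| | |].
      + by move/eqP; rewrite -e mulf_eq0 => /orP[] /eqP.
      + by move/(unit_inMl Sx Sw).
      + move=> a b Sa Sb exw; have [w' uw' ww'] := unit_in_inv uw.
        have Sw' := unit_in_sub uw'.
        case: (xh a (b * w')) => //; first exact: SM.
          by rewrite mulrA -exw -mulrA ww' mulr1.
          by left.
        by move/(unit_inMl Sb Sw'); right.
    - by exists w.
    - by rewrite big_nil mulr1.
  have w0 : w <> 0.
    move=> w0; move: e; rewrite w0 mulr0 => /eqP; rewrite mulf_eq0.
    by move/orP => -[] /eqP.
  have [s3 irr3 e3] := ex w Sw w0 wN; exists x, s3; split=> //; last by rewrite -e3.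
  by exists 1; rewrite ?mulr1.
have := uniq (x' :: s3) (s1 ++ s2).
rewrite big_cons big_cat /= e3 -e1 -e2 => /(_ _ irr12 erefl)[].
  by move=> t; rewrite in_cons => /orP[/eqP -> //|/irr3].
case=> [|b s] /perm_mem eqs F; first by inversion F.
have [[v uv eb] _] := (List.Forall2_cons_iff (associated_in S) x' b s3 s).1 F.
have bs : b \in s1 ++ s2 by rewrite -eqs mem_head.
have dxb : divides_in S x b; first by rewrite eb; apply: divides_in_mulr => //; case: uv.
move: bs; rewrite mem_cat => /orP[] bs; [left|right].
  apply: divides_in_trans dxb _; rewrite e1; apply: divides_in_mem => // t /irr1 [] //.
apply: divides_in_trans dxb _; rewrite e2; apply: divides_in_mem => // t /irr2 [] //.
Qed.

Lemma factorial_prime_factorable x :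
  factorial_in S -> S x -> x <> 0 -> prime_factorable S x.
Proof.
move=> fS Sx x0; have [ux|xN] := classic (unit_in S x).
  exact: prime_factorable_unit.
have [ex _] := fS; have [s irrs e] := ex x Sx x0 xN; exists 1, s.
split; [exact: unit_in1 | | by rewrite mul1r].
by move=> p /irrs; apply: factorial_irreducible_prime.
Qed.

Lemma prime_factorable_factorial :
  (forall x, S x -> x <> 0 -> prime_factorable S x) -> factorial_in S.
Proof.
move=> pf.
have irrP y : irreducible_in S y -> prime_in S y.
  by move=> irry; apply: irreducible_prime (irry); apply: pf; case: irry.
split=> [x Sx x0 xN|].
  have [u [[|p s] [uu ps e]]] := pf x Sx x0.
    by case: xN; rewrite e big_nil mulr1.
  exists (p * u :: s); last by rewrite e !big_cons mulrA (mulrC u).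
  move=> q; rewrite in_cons => /orP[/eqP ->|qs]; apply: prime_irreducible.
    by apply: prime_in_unit_mul => //; apply: ps; rewrite mem_head.
  by apply: ps; rewrite in_cons qs orbT.
(* The unit [u] is needed for the induction: cancelling [y] against an associate of it in [s2]
   leaves a unit behind. *)
suff H s1 s2 u : unit_in S u ->
    (forall y, y \in s1 -> irreducible_in S y) ->
    (forall y, y \in s2 -> irreducible_in S y) ->
    u * \prod_(y <- s1) y = \prod_(y <- s2) y ->
    exists2 s : seq R, perm_eq s s2 & List.Forall2 (associated_in S) s1 s.
  by move=> s1 s2 i1 i2 e; apply: (H s1 s2 1) => //; [apply: unit_in1 | rewrite mul1r].
elim: s1 s2 u => [|y s1 IHs] s2 u uu irr1 irr2.
  rewrite big_nil mulr1; case: s2 irr2 => [|z s2] irr2 e; first by exists [::].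
  have Ss : S (\prod_(y <- s2) y).
    by apply: Sprod => t ts; case: (irr2 t); rewrite // in_cons ts orbT.
  have [Sz _ zN _] := irr2 z (mem_head _ _).
  by case: zN; apply: (unit_inMl Sz Ss); move: e; rewrite big_cons => <-.
have irry := irr1 y (mem_head _ _); have py := irrP _ irry.
have [Sy /eqP y0 yN _] := py.
have irr1' t : t \in s1 -> irreducible_in S t.
  by move=> ts; apply: irr1; rewrite in_cons ts orbT.
have Ss1 : S (\prod_(y <- s1) y) by apply: Sprod => t /irr1' [].
rewrite big_cons => e.
have dy : divides_in S y (\prod_(y <- s2) y).
  by rewrite -e mulrCA; exists (u * \prod_(y <- s1) y) => //; apply: SM => //; case: uu.
have [z zs [w Sw ez]] := prime_in_prod py (fun t ts => let: And4 St _ _ _ := irr2 t ts in St) dy.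
have [Sz z0 zN zh] := irr2 z zs.
have uw : unit_in S w by case: (zh y w).
have [w' uw' ww'] := unit_in_inv uw.
have irr2' t : t \in rem z s2 -> irreducible_in S t by move/mem_rem/irr2.
have [||s ps Fs] := IHs (rem z s2) (u * w') _ irr1' irr2'.
- exact: unit_inM.
- apply: (mulfI y0); move: e; rewrite (big_rem z zs) /=; move: (\prod_(y <- rem z s2) y) => P2.
  move: (\prod_(y <- s1) y) => P1 e.
  have -> : y * (u * w' * P1) = (u * (y * P1)) * w' by ring.
  by rewrite e {1}ez -[RHS]mulr1 -ww'; ring.
exists (z :: s); last by constructor=> //; exists w.
by rewrite perm_sym (permPl (perm_to_rem zs)) perm_cons perm_sym.
Qed.

End Factoring.

(** * Gauss' lemma *)

Definition everything (R : Type) (_ : R) : Prop := True.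

Lemma subring_everything (R : pzRingType) : subring (@everything R).
Proof. by []. Qed.
#[local] Hint Resolve subring_everything : core.

Section Gauss.
Variable R : idomainType.
Hypothesis pfR : forall x : R, x <> 0 -> prime_factorable (@everything R) x.
Local Notation TR := (@everything R).
Local Notation TP := (@everything {poly R}).
Implicit Types (a b c p : R) (f g h q r : {poly R}).

Let subR := subring_everything R.
Let subP := subring_everything {poly R}.

Lemma polyC_unit_in c : unit_in TP c%:P <-> unit_in TR c.
Proof.
split=> -[_ [d _ e]]; split=> //.
  by exists d.[0] => //; rewrite -[c](hornerC c 0) -hornerM e hornerC.
by exists d%:P => //; rewrite -polyCM e.
Qed.

Lemma unit_in_size f : unit_in TP f -> exists2 c, f = c%:P & unit_in TR c.
Proof.
move=> uf; have [_ [g _ e]] := uf.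
have f0 : f != 0 by apply/eqP; apply: unit_in_neq0 uf.
have g0 : g != 0 by apply: contra_eq_neq e => ->; rewrite mulr0 eq_sym oner_eq0.
have := size_mul f0 g0; rewrite e size_poly1 => e1.
have sf := f0; have sg := g0; rewrite -size_poly_gt0 in sf; rewrite -size_poly_gt0 in sg.
have /size_poly1P [c c0 ec] : size f == 1%N by apply/eqP; lia.
by exists c => //; apply/polyC_unit_in; rewrite -ec.
Qed.

(** If [p] divides [f * g], it divides the product of the leading coefficients, hence one of them;
    removing that leading term lowers the total size and keeps [p] a divisor of the product. *)
Lemma polyC_prime_in p : prime_in TR p -> prime_in TP p%:P.
Proof.
case=> _ /eqP p0 pN ph; split=> //; first by apply/eqP; rewrite polyC_eq0.
  by move/polyC_unit_in.
move=> f g _ _; move: {2}(size f + size g).+1 (ltnSn (size f + size g)) => k.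
elim: k f g => // k IHk f g; rewrite ltnS => lek [h _ e].
have [->|f0] := eqVneq f 0; first by left; exists 0; rewrite ?mulr0.
have [->|g0] := eqVneq g 0; first by right; exists 0; rewrite ?mulr0.
have split_lead q : q != 0 -> exists2 r : {poly R}, (size r < size q)%N
    & q = r + (lead_coef q)%:P * 'X^((size q).-1).
  move=> q0; exists (q - lead_coef q *: 'X^((size q).-1)); last first.
    by rewrite mul_polyC subrK.
  have sq : (0 < size q)%N by rewrite size_poly_gt0.
  have le : (size (q - lead_coef q *: 'X^((size q).-1))%R <= size q)%N.
    rewrite (leq_trans (size_polyD _ _)) // geq_max leqnn size_polyN.
    by rewrite (leq_trans (size_scale_leq _ _)) // size_polyXn prednK.
  rewrite ltn_neqAle le andbT; apply/eqP => es.
  have : lead_coef (q - lead_coef q *: 'X^((size q).-1)) = 0.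
    by rewrite lead_coefE es coefB coefZ coefXn eqxx mulr1 -lead_coefE subrr.
  by move/eqP; rewrite lead_coef_eq0 => /eqP z; move: sq; rewrite -es z size_poly0.
have lead_dvd q r : (size r < size q)%N -> q = r + (lead_coef q)%:P * 'X^((size q).-1) ->
    divides_in TR p (lead_coef q) -> divides_in TP p%:P r -> divides_in TP p%:P q.
  move=> _ {2}-> [d _ ->] [t _ ->]; exists (t + d%:P * 'X^((size q).-1)) => //.
  by rewrite polyCM mulrDr mulrA.
have : divides_in TR p (lead_coef f * lead_coef g).
  by rewrite -lead_coefM e lead_coefM lead_coefC; exists (lead_coef h).
case/ph => // -[d _ ed].
- have [r ltr er] := split_lead f f0.
  have [||dr|] := IHk r g; [by apply: leq_trans lek; rewrite ltn_add2r | | |by right].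
    exists (h - d%:P * 'X^((size f).-1) * g) => //; rewrite mulrBr -e.
    by rewrite [in X in X - _]er ed polyCM; ring.
  by left; apply: lead_dvd ltr er _ dr; exists d.
- have [r ltr er] := split_lead g g0.
  have [||?|dr] := IHk f r; [by apply: leq_trans lek; rewrite ltn_add2l | | by left|].
    exists (h - d%:P * 'X^((size g).-1) * f) => //; rewrite mulrBr -e.
    by rewrite [in X in X - _]er ed polyCM; ring.
  by right; apply: lead_dvd ltr er _ dr; exists d.
Qed.

(** The prime factors of [c] stay prime as constant polynomials, so each can be cancelled from [f]
    or from [q]. This takes the place of contents. *)
Lemma cancel_content c h f q : c != 0 -> c%:P * h = f * q ->
  exists a b f' q', [/\ f = a%:P * f', q = b%:P * q' & h = f' * q'].
Proof.
move/eqP/pfR => [u [s [uu ps ->]]]; have [v _ uv] := unit_in_inv uu.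
elim: s h f q ps => [|p s IHs] h f q ps.
  rewrite big_nil mulr1 => e; exists 1, u, f, (v%:P * q).
  split; [by rewrite mul1r | by rewrite mulrA -polyCM uv mul1r |].
  by rewrite mulrCA -e mulrA -polyCM [v * u]mulrC uv mul1r.
have ps' a : a \in s -> prime_in TR a by move=> rs; apply: ps; rewrite in_cons rs orbT.
have pp := polyC_prime_in (ps p (mem_head _ _)); have [_ /eqP p0 _ ph] := pp.
rewrite big_cons mulrCA polyCM -mulrA => e.
case: (ph f q) => //; first by rewrite -e; exists ((u * \prod_(j <- s) j)%:P * h).
- case=> f1 _ ef; have [|a [b [f' [q' [e1 e2 e3]]]]] := IHs h f1 q ps'.
    by apply: (mulfI p0); rewrite e ef mulrA.
  by exists (p * a), b, f', q'; rewrite ef e1 polyCM mulrA.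
- case=> q1 _ eq; have [|a [b [f' [q' [e1 e2 e3]]]]] := IHs h f q1 ps'.
    by apply: (mulfI p0); rewrite e eq mulrCA.
  by exists a, (p * b), f', q'; rewrite eq e2 polyCM mulrA.
Qed.

(** [Pdiv.Idomain.dvdp] is divisibility up to a non-zero constant, that is, over the fraction field.
    For primitive [f] the constant that [cancel_content] extracts from [f] is a unit. *)
Lemma primitive_dvdp f h : (forall a f', f = a%:P * f' -> unit_in TR a) ->
  Pdiv.Idomain.dvdp f h -> divides_in TP f h.
Proof.
move=> prim /Pdiv.Idomain.dvdpP[[c q] /= c0]; rewrite -mul_polyC mulrC => e.
have [|a [b [f' [q' [e1 _ ->]]]]] := cancel_content (c := c) (h := h) (f := f) (q := q) c0.
  by rewrite mulrC e mulrC.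
have [v _ av] := unit_in_inv (prim _ _ e1); exists (v%:P * q') => //.
by rewrite e1 mulrACA -polyCM av mul1r.
Qed.

Lemma poly_irreducible_prime f : irreducible_in TP f -> prime_in TP f.
Proof.
move=> irrf; have [_ f0 fN fh] := irrf.
have [/eqP/size_poly1P[c c0 ec]|sf] := eqVneq (size f) 1%N.
  rewrite ec; apply/polyC_prime_in/(irreducible_prime subR); first by apply/pfR/eqP.
  split=> //; [exact/eqP | by move/polyC_unit_in; rewrite -ec |].
  move=> a b _ _ e; have := fh a%:P b%:P I I.
  rewrite ec e polyCM => /(_ erefl)[/polyC_unit_in|/polyC_unit_in]; by [left | right].
have prim a f' : f = a%:P * f' -> unit_in TR a.
  move=> e; case: (fh _ _ I I e) => [/polyC_unit_in //|/unit_in_size[c ec _]].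
  move: sf f0; rewrite e ec -polyCM size_polyC.
  by have [->|] := eqVneq (a * c) 0; rewrite ?polyC0.
split=> // g h _ _ dgh.
have dvdgh : Pdiv.Idomain.dvdp f (g * h).
  by case: dgh => w _ ->; apply: dvdp_mulIl.
(* Clearing constants turns the gcd of [f] and [g] into a true factorization [f = q' * d']. If [q']
   is a unit, the gcd is [f] up to constants and [f] divides [g]; if [d'] is one, [f] and [g] are
   coprime over the fraction field and [f] divides [h]. *)
have /Pdiv.Idomain.dvdpP[[c q] /= c0] := dvdp_gcdl f g.
rewrite -mul_polyC => /(cancel_content c0)[a [b [q' [d' [e1 e2 e3]]]]].
case: (fh _ _ I I e3) => [/unit_in_size[u eu uu]|/unit_in_size[u eu uu]].
- left; apply: (primitive_dvdp prim); apply: dvdp_trans (dvdp_gcdr f g).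
  by rewrite e2 e3 eu; have [v _ uv] := unit_in_inv uu; apply/Pdiv.Idomain.dvdpP;
  exists (u, b%:P) => /=; [apply/eqP/(unit_in_neq0 uu) | rewrite -mul_polyC; ring].
- right; apply: (primitive_dvdp prim); rewrite -(@Gauss_dvdpr _ h g f) //.
  rewrite coprimep_def e2 eu -polyCM size_polyC; have [bu0|//] := eqVneq (b * u) 0.
  have : gcdp f g == 0 by rewrite e2 eu -polyCM bu0.
  by rewrite gcdp_eq0 => /andP[/eqP].
Qed.

Lemma poly_prime_factorable f : f <> 0 -> prime_factorable TP f.
Proof.
move=> f0; have /pfR[u [s [uu ps e]]] : lead_coef f <> 0.
  by apply/eqP; rewrite lead_coef_eq0; apply/eqP.
(* The measure adds to the size the number of primes in the leading coefficient. It is at least 2 on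
   non-units, while the sizes of two factors sum to one more than the size of the product; so both
   factors of a proper splitting have smaller measure, constant factors included. *)
move: {2}(size f + size s).+1 (ltnSn (size f + size s)) => k.
elim: k f f0 u s uu ps e => // k IHk f f0 u s uu ps e lek.
have [uf|fN] := classic (unit_in TP f); first exact: prime_factorable_unit.
have [irr|red] := classic (irreducible_in TP f).
  exact/(prime_factorable_prime subP)/poly_irreducible_prime.
have [g [h [ef gN hN]]] : exists g h, [/\ f = g * h, ~ unit_in TP g & ~ unit_in TP h].
  apply: NNPP => no; apply: red; split=> // g h _ _ ef.
  have [?|gN] := classic (unit_in TP g); first by left.
  by right; apply: NNPP => hN; apply: no; exists g, h.
have g0 : g <> 0 by move=> g0; apply: f0; rewrite ef g0 mul0r.
have h0 : h <> 0 by move=> h0; apply: f0; rewrite ef h0 mulr0.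
have sg : (0 < size g)%N by rewrite size_poly_gt0; apply/eqP.
have sh : (0 < size h)%N by rewrite size_poly_gt0; apply/eqP.
have elead : lead_coef g * lead_coef h = u * \prod_(p <- s) p by rewrite -lead_coefM -ef.
have [v [s1 [w [s2 [uv uw sub1 sub2 [e1 e2 e3]]]]]] := prime_factor_mul subR I I uu ps elead.
have size_pos q t z : q <> 0 -> ~ unit_in TP q -> unit_in TR z ->
    lead_coef q = z * \prod_(p <- t) p -> (1 < size q + size t)%N.
  move=> /eqP q0 qN uz eq; rewrite ltnNge; apply/negP => le1.
  have sq : (0 < size q)%N by rewrite size_poly_gt0.
  have /size_poly1P[c c0 ec] : size q == 1%N.
    by rewrite eqn_leq sq andbT (leq_trans (leq_addr _ _) le1).
  have t0 : size t = 0%N.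
    by move: le1 sq; case: (size q) => // i; rewrite addSn ltnS leqn0 addn_eq0 => /andP[_ /eqP].
  apply: qN; rewrite ec; apply/polyC_unit_in; rewrite -[c]lead_coefC -ec eq.
  by rewrite (size0nil t0) big_nil mulr1.
have := size_mul (introN eqP g0) (introN eqP h0); rewrite -ef => es.
have l1 := size_pos g s1 v g0 gN uv e1; have l2 := size_pos h s2 w h0 hN uw e2.
have arith (a b x y c d : nat) : (0 < a -> x = (a + b).-1 -> y = c + d -> x + y < k.+1 ->
  1 < b + d -> a + c < k)%N by lia.
rewrite ef; apply: (prime_factorableM subP).
- apply: (IHk g g0 v s1) => //; first by move=> p /sub1/ps.
  exact: arith es e3 lek l2.
- apply: (IHk h h0 w s2) => //; first by move=> p /sub2/ps.
  by rewrite addnC in es; rewrite addnC in e3; apply: arith es e3 lek l1.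
Qed.

End Gauss.

(** Multiplicativity of [f] follows from that of its inverse [g], so only one direction has to be
    built as a morphism. *)
Lemma prime_factorable_iso (R1 R2 : idomainType) (f : R1 -> R2) (g : {rmorphism R2 -> R1}) :
  cancel f g -> cancel g f ->
  (forall x : R1, x <> 0 -> prime_factorable (@everything R1) x) ->
  forall x : R2, x <> 0 -> prime_factorable (@everything R2) x.
Proof.
move=> fK gK pf1 x x0; have gI := can_inj gK.
have fM : {morph f : y z / y * z} by move=> y z; apply: gI; rewrite rmorphM !fK.
have f1 : f 1 = 1 by apply: gI; rewrite fK rmorph1.
have /pf1 [u [s [[_ [v _ uv]] ps e]]] : g x <> 0.
  by move=> e; apply: x0; apply: gI; rewrite e rmorph0.
exists (f u), (map f s); split.
- by split=> //; exists (f v) => //; rewrite -fM uv.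
- move=> _ /mapP[p /ps [_ p0 pN ph] ->]; split=> //.
  + by move=> e0; apply: p0; rewrite -(fK p) e0 rmorph0.
  + case=> _ [y _ py]; apply: pN; split=> //; exists (g y) => //.
    by rewrite -[p]fK -rmorphM py rmorph1.
  + move=> y z _ _ [w _ e1]; case: (ph (g y) (g z)) => //.
    * by exists (g w); rewrite // -{1}[p]fK -!rmorphM e1.
    * by case=> t _ e2; left; exists (f t); rewrite -?fM -?e2 ?gK.
    * by case=> t _ e2; right; exists (f t); rewrite -?fM -?e2 ?gK.
- by rewrite big_map -(big_morph _ fM f1) -fM -e gK.
Qed.

Lemma mpoly_gen_ind (R : comNzRingType) (n : nat) (P : {mpoly R[n]} -> Prop) :
  (forall c, P c%:MP) -> (forall i, P 'X_i) ->
  (forall p q, P p -> P q -> P (p + q)) -> (forall p q, P p -> P q -> P (p * q)) ->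
  forall p, P p.
Proof.
move=> PC PX PD PM; apply: mpolyind => [|c m p _ _ Pp]; first exact: (PC 0).
apply: (PD) => //; rewrite -mul_mpolyC; apply: (PM) => //; rewrite mpolyXE_id.
apply: (big_ind P) => [||i _]; [exact: (PC 1) | exact: PM |].
elim: (m i) => [|k IHk]; first exact: (PC 1).
by rewrite exprS; apply: PM.
Qed.

Lemma mpoly_rmorph_eq (R : comNzRingType) (S : nzRingType) (n : nat)
  (f g : {rmorphism {mpoly R[n]} -> S}) :
  (forall c, f c%:MP = g c%:MP) -> (forall i, f 'X_i = g 'X_i) -> f =1 g.
Proof.
move=> fgC fgX; elim/mpoly_gen_ind => // p q ep eq.
  by rewrite (rmorphD f) (rmorphD g) ep eq.
by rewrite (rmorphM f) (rmorphM g) ep eq.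
Qed.

Lemma mpoly_rmorph_ex (R S : comNzRingType) (n : nat) (phi : {rmorphism R -> S})
  (V : 'I_n -> S) : exists g : {rmorphism {mpoly R[n]} -> S},
  (forall c, g c%:MP = phi c) /\ (forall i, g 'X_i = V i).
Proof.
by exists (mmap phi V); split=> [c|i] /=; rewrite ?mmapC ?mmapX ?mmap1U.
Qed.

Lemma mpoly_prime_factorable (R : idomainType) (n : nat) :
  (forall x : R, x <> 0 -> prime_factorable (@everything R) x) ->
  forall p : {mpoly R[n]}, p <> 0 -> prime_factorable (@everything {mpoly R[n]}) p.
Proof.
move=> pfR; elim: n => [|n IHn].
  apply: (@prime_factorable_iso R _ (@mpolyC 0 R) (meval (fun=> 0))) => //.
    by move=> c; rewrite /= mevalC.
  move=> p /=; elim/mpoly_gen_ind: p => [c|[]|p q ep eq|p q ep eq] //.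
  - by rewrite mevalC.
  - by rewrite mevalD mpolyCD ep eq.
  - by rewrite mevalM mpolyCM ep eq.
(* [g] makes the last variable the indeterminate of a univariate polynomial ring; the inverse [f]
   evaluates at that variable. *)
have [g [gC gX]] := mpoly_rmorph_ex (polyC \o @mpolyC n R)
  (fun i => if unlift ord_max i is Some j then ('X_j)%:P else 'X).
have [h [hC hX]] := mpoly_rmorph_ex (@mpolyC n.+1 R) (fun j : 'I_n => 'X_(lift ord_max j)).
have [f [fC fX fD fM]] : exists f : {poly {mpoly R[n]}} -> {mpoly R[n.+1]},
    [/\ forall c, f c%:P = h c, f 'X = 'X_ord_max, {morph f : p q / p + q}
      & {morph f : p q / p * q}].
  exists (fun q => (map_poly h q).['X_ord_max]); split=> [c||p q|p q].
  - by rewrite map_polyC hornerC.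
  - by rewrite map_polyX hornerX.
  - by rewrite rmorphD hornerD.
  - by rewrite rmorphM hornerM.
have hK c : g (h c) = c%:P.
  apply: (mpoly_rmorph_eq (f := g \o h) (g := polyC) _ _ c) => [{}c|i] /=.
    by rewrite hC gC.
  by rewrite hX gX liftK.
apply: (@prime_factorable_iso _ _ f g) (poly_prime_factorable IHn).
- elim/poly_ind => [|q c eq]; first by rewrite -polyC0 fC rmorph0 rmorph0.
  by rewrite fD fM (rmorphD g) (rmorphM g) eq fC hK fX gX unlift_none.
- elim/mpoly_gen_ind => [c|i|p q ep eq|p q ep eq].
  - by rewrite gC /= fC hC.
  - by rewrite gX; case: unliftP => [j ->|->]; rewrite ?fC ?fX ?hX.
  - by rewrite (rmorphD g) fD ep eq.
  - by rewrite (rmorphM g) fM ep eq.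
Qed.

(** * Laurent rings of seeds *)

Definition pospart (x : int) : int := Num.max x 0.

Lemma pospart_ge0 x : 0 <= pospart x.
Proof. by rewrite /pospart; lia. Qed.

Lemma pospartB x : pospart x - pospart (- x) = x.
Proof. by rewrite /pospart; lia. Qed.

Lemma pospart_eq0 x : pospart x = 0 \/ pospart (- x) = 0.
Proof. by rewrite /pospart; lia. Qed.

Lemma pospart_min x : x - Num.min 0 x = pospart x.
Proof. by rewrite /pospart; lia. Qed.

Lemma pospartN_min x : - Num.min 0 x = pospart (- x).
Proof. by rewrite /pospart; lia. Qed.

(** The right-hand side is the rule that the coefficients obey too, which lets [ext_mut] treat both
    blocks of the extended matrix at once. *)
Lemma sg_max_mul (x y : int) :
  Num.sg x * Num.max (x * y) 0 = x * pospart y + pospart (- x) * y.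
Proof.
rewrite /pospart; case: (sgrP x) => [->|x0|x0]; first by lia.
- have -> : Num.max (- x) 0 = 0 by lia.
  have [y0|y0] : 0 <= y \/ y < 0 by lia.
    have xy0 : 0 <= x * y by rewrite mulr_ge0 // ltW.
    have -> : Num.max (x * y) 0 = x * y by lia.
    have -> : Num.max y 0 = y by lia.
    by ring.
  have xy0 : x * y < 0 by rewrite pmulr_rlt0.
  have -> : Num.max (x * y) 0 = 0 by lia.
  have -> : Num.max y 0 = 0 by lia.
  by ring.
- have -> : Num.max (- x) 0 = - x by lia.
  have [y0|y0] : 0 <= y \/ y < 0 by lia.
    have xy0 : x * y <= 0 by rewrite nmulr_rle0.
    have -> : Num.max (x * y) 0 = 0 by lia.
    have -> : Num.max y 0 = y by lia.
    by ring.
  have xy0 : 0 < x * y by rewrite nmulr_rgt0.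
  have -> : Num.max (x * y) 0 = x * y by lia.
  have -> : Num.max y 0 = 0 by lia.
  by ring.
Qed.

Section Seeds.
Variables (K : idomainType) (m n : nat).
Local Notation F := (ambient K m n).
Local Notation W := {mpoly K[m + n]}.
Local Notation preseed := (preseed K m n).
Implicit Types (t : preseed) (a : 'I_m) (k j : 'I_n) (e : 'I_(m + n) -> int).

Definition vars t (i : 'I_(m + n)) : F :=
  match split i with inl a => coefvar K n a | inr j => cluster t j end.

Definition ev t : {rmorphism W -> F} := locked
  (mmap (@tofrac _ \o @mpolyC n _ \o @mpolyC m K) (vars t) : {rmorphism W -> F}).

Definition mon t e : F := \prod_i vars t i ^ e i.

(** This is a column of the extended exchange matrix, with the coefficient rows placed before those
    of [B] to match [vars]. *)
Definition ext t k (i : 'I_(m + n)) : int :=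
  match split i with inl a => coefs t k 0 a | inr j => exmx t j k end.

Lemma split_lshift a : split (lshift n a) = inl a :> 'I_m + 'I_n.
Proof. exact: (unsplitK (inl a)). Qed.

Lemma split_rshift j : split (rshift m j) = inr j :> 'I_m + 'I_n.
Proof. exact: (unsplitK (inr j)). Qed.

Lemma vars_l t a : vars t (lshift n a) = coefvar K n a.
Proof. by rewrite /vars split_lshift. Qed.

Lemma vars_r t j : vars t (rshift m j) = cluster t j.
Proof. by rewrite /vars split_rshift. Qed.

Lemma ext_l t k a : ext t k (lshift n a) = coefs t k 0 a.
Proof. by rewrite /ext split_lshift. Qed.

Lemma ext_r t k j : ext t k (rshift m j) = exmx t j k.
Proof. by rewrite /ext split_rshift. Qed.

Lemma ord_split_ind (P : 'I_(m + n) -> Prop) :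
  (forall a, P (lshift n a)) -> (forall j, P (rshift m j)) -> forall i, P i.
Proof. by move=> Pl Pr i; rewrite -[i]splitK; case: (split i). Qed.

Lemma evC t c : ev t c%:MP = @Defs.scalar K m n c.
Proof. by rewrite /ev -lock /= mmapC. Qed.

Lemma evX t i : ev t 'X_i = vars t i.
Proof. by rewrite /ev -lock /= mmapX mmap1U. Qed.

Lemma eq_mon t e1 e2 : e1 =1 e2 -> mon t e1 = mon t e2.
Proof. by move=> e12; apply: eq_bigr => i _; rewrite e12. Qed.

Lemma evXm t (e : 'X_{1..m + n}) : ev t 'X_[e] = mon t (fun i => (e i)%:Z).
Proof. by rewrite /ev -lock /= mmapX. Qed.

Lemma KP_scalar c : @KP K m n (@Defs.scalar K m n c).
Proof. by apply: subring_gen_in; left; exists c. Qed.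

Lemma KP_trop_mon (c : trop m) : @KP K m n (trop_mon K n c).
Proof. by apply: subring_gen_in; right; exists c. Qed.

Lemma trop_mon_coefvar a : trop_mon K n (delta_mx 0 a) = coefvar K n a.
Proof.
rewrite /trop_mon (bigD1 a) //= big1 => [|i /negbTE ia]; rewrite mxE eqxx ?ia //.
by rewrite eqxx expr1z mulr1.
Qed.

Lemma KP_coefvar a : @KP K m n (coefvar K n a).
Proof. by rewrite -trop_mon_coefvar; apply: KP_trop_mon. Qed.

Lemma KP_subring : subring (@KP K m n).
Proof. exact: subring_genP. Qed.

(** Freeness concerns polynomials in the cluster with coefficients in [KP]. The map [g] regroups
    [K[Z, A]] as [K[Z][A]] and [l] embeds the coefficients into the field; both are injective, the
    result has coefficients in [KP], and [ev t] is its evaluation at the cluster. *)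
Lemma ev_inj t : free_generating (cluster t) -> injective (ev t).
Proof.
case=> free _.
have [f [fC fX]] := mpoly_rmorph_ex
  (@mpolyC n _ \o @tofrac _ \o @mpolyC n _ \o @mpolyC m K)
  (fun i => match split i with inl a => (coefvar K n a)%:MP | inr j => 'X_j end
     : {mpoly F[n]}).
have [g [gC gX]] := mpoly_rmorph_ex (@mpolyC n _ \o @mpolyC m K)
  (fun i => match split i with inl a => ('X_a)%:MP | inr j => 'X_j end
     : {mpoly {mpoly K[m]}[n]}).
have [h1 [h1C h1X]] := mpoly_rmorph_ex (@mpolyC (m + n) K)
  (fun a : 'I_m => 'X_(lshift n a)).
have [h [hC hX]] := mpoly_rmorph_ex h1 (fun j : 'I_n => 'X_(rshift m j)).
pose l : {rmorphism {mpoly {mpoly K[m]}[n]} -> {mpoly F[n]}} :=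
  map_mpoly (@tofrac _ \o @mpolyC n _).
have lC c : l c%:MP = (tofrac c%:MP)%:MP by rewrite /l /= map_mpolyC.
have lX j : l 'X_j = 'X_j by rewrite /l /= map_mpolyX.
have lE p u : (l p)@_u = tofrac (p@_u)%:MP by exact: mcoeff_map_mpoly.
clearbody l.
have li : injective l.
  move=> p q e; apply/mpolyP => u; have : (l p)@_u = (l q)@_u by rewrite e.
  by rewrite !lE => /eqP; rewrite tofrac_eq => /eqP/(can_inj (@mpolyCK n _)).
have gK : cancel g h.
  move=> p; apply: (mpoly_rmorph_eq (f := h \o g) (g := idfun) _ _ p) => [c|i] /=.
    by rewrite gC /= hC h1C.
  rewrite gX -[X in _ = 'X_X](splitK i); case: (split i) => a /=.
    by rewrite hC h1X.
  by rewrite hX.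
have flg p : f p = l (g p).
  apply: (mpoly_rmorph_eq (f := f) (g := l \o g) _ _ p) => [c|i] /=.
    by rewrite fC gC lC.
  by rewrite fX gX; case: (split i) => a; rewrite ?lC ?lX.
have fev p : (f p).@[cluster t] = ev t p.
  apply: (mpoly_rmorph_eq (f := meval (cluster t) \o f) (g := ev t) _ _ p) => [c|i] /=.
    by rewrite fC /= mevalC evC.
  rewrite evX fX /vars; case: (split i) => a; first by rewrite mevalC.
  by rewrite mevalXU.
have fKP p : KP_poly (f p).
  have K01 (b : bool) : @KP K m n b%:R.
    by case: b; [exact: (subring1 KP_subring) | exact: (subring0 KP_subring)].
  elim/mpoly_gen_ind: p => [c|i|p q ep eq|p q ep eq] e.
  - by rewrite fC /= mcoeffC; apply: (subringM KP_subring) => //; exact: KP_scalar.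
  - rewrite fX; case: (split i) => a; rewrite ?mcoeffC ?mcoeffX //.
    by apply: (subringM KP_subring) => //; exact: KP_coefvar.
  - by rewrite (rmorphD f) mcoeffD; apply: (subringD KP_subring).
  - rewrite (rmorphM f) mcoeffM; apply: (subring_sum KP_subring) => i _.
    exact: (subringM KP_subring).
move=> p q e; have /(free _ (fKP _)) : (f (p - q)).@[cluster t] = 0.
  by rewrite fev (rmorphB (ev t)) e subrr.
rewrite (rmorphB f) => /eqP; rewrite subr_eq0 !flg => /eqP/li.
exact: (can_inj gK).
Qed.

Section OneSeed.
Variable t : preseed.
Hypothesis free_t : free_generating (cluster t).
Local Notation L := (laurent t).

Let evI := ev_inj free_t.

Lemma vars_neq0 i : vars t i != 0.
Proof.
rewrite -evX -(rmorph0 (ev t)) (inj_eq evI); apply/eqP => /(congr1 (mcoeff U_(i)%MM)).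
by rewrite mcoeffX eqxx mcoeff0 => /eqP; rewrite oner_eq0.
Qed.

Lemma monD e1 e2 : mon t (fun i => e1 i + e2 i) = mon t e1 * mon t e2.
Proof.
by rewrite /mon -big_split; apply: eq_bigr => i _; rewrite expfzDr // vars_neq0.
Qed.

Lemma mon0 : mon t (fun=> 0) = 1.
Proof. by rewrite /mon big1. Qed.

Lemma mon_neq0 e : mon t e != 0.
Proof. by apply/prodf_neq0 => i _; rewrite expfz_neq0 // vars_neq0. Qed.

Lemma monN e : mon t (fun i => - e i) = (mon t e)^-1.
Proof.
apply: (mulfI (mon_neq0 e)); rewrite -monD divff ?mon_neq0 // -[RHS]mon0.
by apply: eq_mon => i; rewrite subrr.
Qed.

Lemma monXn e (k : nat) : mon t (fun i => e i * k%:Z) = mon t e ^+ k.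
Proof.
elim: k => [|k IHk]; first by rewrite expr0 -mon0; apply: eq_mon => i; rewrite mulr0.
by rewrite exprS -IHk -monD; apply: eq_mon => i; rewrite intS mulrDr mulr1.
Qed.

Lemma monX e (z : int) : mon t (fun i => e i * z) = mon t e ^ z.
Proof.
case: z => k; first exact: monXn.
by rewrite NegzE -invr_expz -exprnP -monXn -monN; apply: eq_mon => i; rewrite mulrN.
Qed.

Lemma mon_vars i (z : int) : mon t (fun x => if x == i then z else 0) = vars t i ^ z.
Proof.
rewrite /mon (bigD1 i) //= eqxx big1 ?mulr1 // => j /negbTE ->.
by rewrite expr0z.
Qed.

Lemma trop_monE (c : trop m) :
  trop_mon K n c = mon t (fun i => match split i with inl a => c 0 a | inr _ => 0 end).
Proof.
rewrite /mon big_split_ord /= [X in _ * X]big1 ?mulr1 => [|j _].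
  by apply: eq_bigr => a _; rewrite vars_l split_lshift.
by rewrite split_rshift.
Qed.

Lemma laurent_subring : subring L. Proof. exact: subring_genP. Qed.

Lemma laurent_KP f : @KP K m n f -> L f.
Proof. by move=> Kf; apply: subring_gen_in; apply: Or31. Qed.

Lemma laurent_vars i : L (vars t i).
Proof.
elim/ord_split_ind: i => [a|j]; first by rewrite vars_l; apply/laurent_KP/KP_coefvar.
by rewrite vars_r; apply: subring_gen_in; apply: Or32; exists j.
Qed.

Lemma laurent_varsV i : L (vars t i)^-1.
Proof.
elim/ord_split_ind: i => [a|j]; rewrite ?vars_r ?vars_l.
  have -> : (coefvar K n a)^-1 = trop_mon K n (- delta_mx 0 a).
    rewrite -trop_mon_coefvar /trop_mon -prodfV; apply: eq_bigr => i _.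
    by rewrite invr_expz [in RHS]mxE.
  exact/laurent_KP/KP_trop_mon.
by apply: subring_gen_in; apply: Or33; exists j.
Qed.

Lemma laurent_mon e : L (mon t e).
Proof.
apply: (subring_prod laurent_subring) => i _; case: (e i) => k.
  exact/(subringX laurent_subring)/laurent_vars.
rewrite NegzE -invr_expz -exprnP -exprVn.
exact/(subringX laurent_subring)/laurent_varsV.
Qed.

Lemma laurent_ev p : L (ev t p).
Proof.
elim/mpoly_gen_ind: p => [c|i|p q Lp Lq|p q Lp Lq].
- by rewrite evC; apply/laurent_KP/KP_scalar.
- by rewrite evX; apply: laurent_vars.
- by rewrite rmorphD; apply: (subringD laurent_subring).
- by rewrite rmorphM; apply: (subringM laurent_subring).
Qed.

Lemma mon_unit e : unit_in L (mon t e).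
Proof.
split; first exact: laurent_mon.
exists (mon t (fun i => - e i)); first exact: laurent_mon.
by rewrite monN divff // mon_neq0.
Qed.

Lemma ev_mnm_neq0 (u : 'X_{1..m + n}) : ev t 'X_[u] != 0.
Proof. by rewrite evXm mon_neq0. Qed.

(** The localization of the polynomial ring at its monomials, identified with the Laurent ring in
    [laurentP]. *)
Definition has_numerator (f : F) : Prop :=
  exists (u : 'X_{1..m + n}) (p : W), f * ev t 'X_[u] = ev t p.

Lemma has_numerator_subring : subring has_numerator.
Proof.
split=> [|x y [u [p ex]] [v [q ey]]|x y [u [p ex]] [v [q ey]]].
- by exists 0%MM, 1; rewrite mpolyX0 !rmorph1 mulr1.
- exists (u + v)%MM, (p * 'X_[v] - q * 'X_[u]).
  by rewrite mpolyXD rmorphB !rmorphM /= -ex -ey; ring.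
- by exists (u + v)%MM, (p * q); rewrite mpolyXD !rmorphM /= -ex -ey mulrACA.
Qed.

Lemma has_numerator_ev p : has_numerator (ev t p).
Proof. by exists 0%MM, p; rewrite mpolyX0 rmorph1 mulr1. Qed.

Lemma has_numerator_mon e : has_numerator (mon t e).
Proof.
pose u := [multinom absz (pospart (- e i)) | i < m + n].
pose v := [multinom absz (pospart (e i)) | i < m + n].
exists u, 'X_[v]; rewrite !evXm -monD; apply: eq_mon => i; rewrite !mnmE.
rewrite !gez0_abs ?pospart_ge0 // -{1}(pospartB (e i)); ring.
Qed.

Lemma laurentP f : L f <-> has_numerator f.
Proof.
split=> [|[u [p e]]]; last first.
  have -> : f = ev t p * mon t (fun i => - (u i)%:Z).
    by rewrite monN -evXm -e mulfK // ev_mnm_neq0.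
  by apply: (subringM laurent_subring); [exact: laurent_ev | exact: laurent_mon].
apply: (subring_gen_min has_numerator_subring) => {}f [Kf|[j ->]|[j ->]].
- move: f Kf; apply: (subring_gen_min has_numerator_subring) => f [[c ->]|[c ->]].
    by rewrite -(evC t); apply: has_numerator_ev.
  by rewrite trop_monE; apply: has_numerator_mon.
- by rewrite -vars_r -evX; apply: has_numerator_ev.
- have ->  : (cluster t j)^-1 = vars t (rshift m j) ^ (-1) by rewrite exprN1 vars_r.
  by rewrite -mon_vars; apply: has_numerator_mon.
Qed.

End OneSeed.
End Seeds.

(** * Factorization and gradings in a Laurent ring *)

Section MPolyPrimes.
Variables (R : idomainType) (N : nat).
Local Notation W := {mpoly R[N]}.
Local Notation TW := (@everything W).
Implicit Types (p q g : W) (i : 'I_N).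

(** Substitution of 0 for ['X_i]. Its kernel is the ideal of ['X_i], and its fixed points are the
    polynomials free of ['X_i], which is how omitted variables are expressed below. *)
Definition zap i : {rmorphism W -> W} := locked
  (mmap (@mpolyC N R) (fun j => if j == i then 0 else 'X_j) : {rmorphism W -> W}).

Lemma zapC i c : zap i c%:MP = c%:MP. Proof. by rewrite /zap -lock /= mmapC. Qed.
Lemma zapX i j : zap i 'X_j = if j == i then 0 else 'X_j.
Proof. by rewrite /zap -lock /= mmapX mmap1U. Qed.

Lemma zap_decomp i p : exists q, p = zap i p + 'X_i * q.
Proof.
elim/mpoly_gen_ind: p => [c|j|p q [p' ep] [q' eq]|p q [p' ep] [q' eq]].
- by exists 0; rewrite zapC mulr0 addr0.
- rewrite zapX; case: eqP => [->|_]; first by exists 1; rewrite mulr1 add0r.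
  by exists 0; rewrite mulr0 addr0.
- exists (p' + q'); rewrite (rmorphD (zap i)).
  by rewrite [in LHS]ep [in LHS]eq; ring.
- exists (zap i p * q' + p' * zap i q + p' * 'X_i * q').
  by rewrite (rmorphM (zap i)) [in LHS]ep [in LHS]eq; ring.
Qed.

Lemma dvd_zap i p : divides_in TW 'X_i p <-> zap i p = 0.
Proof.
split=> [[q _ ->]|e]; first by rewrite (rmorphM (zap i)) zapX eqxx mul0r.
by have [q ->] := zap_decomp i p; rewrite e add0r; exists q.
Qed.

Lemma mpolyX_neq0 (u : 'X_{1..N}) : 'X_[u] != 0 :> W.
Proof.
apply/eqP => /(congr1 (mcoeff u)); rewrite mcoeffX eqxx mcoeff0 => /eqP.
by rewrite oner_eq0.
Qed.

Lemma mpolyXU_prime i : prime_in TW 'X_i.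
Proof.
split=> //; first exact/eqP/mpolyX_neq0.
  case=> _ [y _ /(congr1 (zap i))]; rewrite (rmorphM (zap i)) zapX eqxx mul0r rmorph1.
  by move/eqP; rewrite eq_sym oner_eq0.
move=> p q _ _ /dvd_zap; rewrite (rmorphM (zap i)) => /eqP; rewrite mulf_eq0.
by case/orP => /eqP /dvd_zap; [left | right].
Qed.

Lemma mpoly_unitP p : unit_in TW p -> exists2 c, c \is a GRing.unit & p = c%:MP.
Proof.
case=> _ [q _]; rewrite mulrC => /mpoly_intro_unit /andP[/eqP e u].
by exists p@_0%MM.
Qed.

(** Variables are prime, so each variable of the monomial can be cancelled from [g] or from [p], by
    induction on the degree. *)
Lemma mnm_divisor (u : 'X_{1..N}) g p : g * p = 'X_[u] ->
  exists c v, c \is a GRing.unit /\ g = c%:MP * 'X_[v].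
Proof.
move: {2}(mdeg u) (erefl (mdeg u)) => d; elim: d u g p => [|d IHd] u g p.
  move/eqP; rewrite mdeg_eq0 => /eqP ->; rewrite mpolyX0 => e.
  have [|c uc ->] := @mpoly_unitP g; first by split=> //; exists p.
  by exists c, 0%MM; rewrite mpolyX0 mulr1.
move=> du e; have [i ui] : exists i, u i != 0%N.
  apply: NNPP => no; suff u0 : u = 0%MM by rewrite u0 mdeg0 in du.
  apply/mnmP => i; rewrite mnm0E; apply/eqP/negbNE/negP => ui.
  by apply: no; exists i.
have eu : u = (U_(i) + (u - U_(i)))%MM by rewrite addmC submK // lep1mP.
have du' : mdeg (u - U_(i))%MM = d by move: du; rewrite {1}eu mdegD mdeg1 => -[].
have X0 := mpolyX_neq0 U_(i)%MM.
have [_ _ _ Xp] := mpolyXU_prime i.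
case: (Xp g p) => //; first by rewrite e eu mpolyXD; exists 'X_[u - U_(i)].
- case=> g' _ eg; have [|c [v [uc e']]] := IHd _ g' p du'.
    by apply: (mulfI X0); rewrite mulrA -eg e {1}eu mpolyXD.
  by exists c, (U_(i) + v)%MM; rewrite eg e' mpolyXD mulrCA.
- case=> p' _ ep; apply: (IHd _ g p' du').
  by apply: (mulfI X0); rewrite mulrCA -ep e {1}eu mpolyXD.
Qed.

End MPolyPrimes.

Arguments zap {R N} i.

Section Localization.
Variables (K : idomainType) (m n : nat) (t : preseed K m n).
Local Notation F := (ambient K m n).
Local Notation W := {mpoly K[m + n]}.
Local Notation L := (laurent t).
Local Notation TW := (@everything W).
Hypothesis free_t : free_generating (cluster t).
Let evI := ev_inj free_t.
Let subL := laurent_subring t.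
Let ev0 := ev_mnm_neq0 free_t.
Let evM := rmorphM (ev t).
Let evD := rmorphD (ev t).

Lemma evXD u v : ev t 'X_[u + v] = ev t 'X_[u] * ev t 'X_[v].
Proof. by rewrite mpolyXD evM. Qed.

Lemma laurent_frac p (u : 'X_{1..m + n}) f : f * ev t 'X_[u] = ev t p ->
  f = ev t p * mon t (fun i => - (u i)%:Z).
Proof. by rewrite monN // -evXm => <-; rewrite mulfK. Qed.

Lemma laurent_unitP f : unit_in L f ->
  exists c e, c \is a GRing.unit /\ f = @Defs.scalar K m n c * mon t e.
Proof.
case=> /(laurentP free_t)[u [p ep]] [g /(laurentP free_t)[v [q eq]] fg].
have /mnm_divisor[c [w [uc e]]] : p * q = 'X_[u + v].
  by apply: evI; rewrite evXD evM -ep -eq mulrACA fg mul1r.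
exists c, (fun i => (w i)%:Z + - (u i)%:Z); split=> //.
by rewrite (laurent_frac ep) e evM evC evXm monD // mulrA.
Qed.

Lemma ev_unit p : unit_in L (ev t p) ->
  exists c u, c \is a GRing.unit /\ p = c%:MP * 'X_[u].
Proof.
case=> _ [g /(laurentP free_t)[v [q eq]] pg]; apply: (@mnm_divisor _ _ v p q).
by apply: evI; rewrite evM -eq mulrA pg mul1r.
Qed.

Lemma ev_prime p : prime_in TW p -> unit_in L (ev t p) \/ prime_in L (ev t p).
Proof.
case=> _ p0 _ ph; have [?|pN] := classic (unit_in L (ev t p)); [by left | right].
split=> //; first exact: laurent_ev.
  by rewrite -(rmorph0 (ev t)) => /evI.
move=> y z Ly Lz [f Lf e].
have [u [q eq]] := (laurentP free_t y).1 Ly.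
have [v [r er]] := (laurentP free_t z).1 Lz.
have [w [s es]] := (laurentP free_t f).1 Lf.
have e1 : q * (r * 'X_[w]) = p * (s * 'X_[u + v]).
  apply: evI; rewrite !evM evXD -eq -er -es.
  transitivity (y * z * (ev t 'X_[u] * ev t 'X_[v] * ev t 'X_[w])); first by ring.
  by rewrite e; ring.
have dv x (x' : W) (x'' : 'X_{1..m + n}) : L x -> x * ev t 'X_[x''] = ev t x' ->
    divides_in TW p x' -> divides_in L (ev t p) x.
  move=> Lx ex [a _ ea]; exists (ev t a * mon t (fun i => - (x'' i)%:Z)).
    by apply: (subringM subL); [apply: laurent_ev | apply: laurent_mon].
  by rewrite (laurent_frac ex) ea evM mulrA.
case: (ph q (r * 'X_[w])) => //; first by exists (s * 'X_[u + v]).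
  by left; apply: dv eq _.
case/ph => //; first by right; apply: dv er _.
(* In the remaining case [p] divides the denominator ['X_[w]], and is then invertible in the Laurent
   ring. *)
case=> a _ ea; case: pN; split; first exact: laurent_ev.
exists (ev t a * mon t (fun i => - (w i)%:Z)).
  by apply: (subringM subL); [apply: laurent_ev | apply: laurent_mon].
by rewrite mulrA -evM -ea monN // -evXm divff.
Qed.

Lemma laurent_prime_factorable : factorial_domain K ->
  forall f, L f -> f <> 0 -> prime_factorable L f.
Proof.
move=> fK f Lf f0; have [u [p ep]] := (laurentP free_t f).1 Lf.
rewrite (laurent_frac ep); apply: (prime_factorableM subL); last first.
  exact/(prime_factorable_unit)/mon_unit.
have p0 : p <> 0.
  move=> p0; apply: f0; apply: (mulIf (ev0 u)).
  by rewrite ep p0 rmorph0 mul0r.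
have pfK (x : K) : x <> 0 -> prime_factorable (@everything K) x.
  by apply: factorial_prime_factorable.
have [w [s [[_ [w' _ ww']] ps ->]]] := mpoly_prime_factorable pfK p0.
rewrite evM rmorph_prod; apply: (prime_factorableM subL).
  apply: prime_factorable_unit; split; first exact: laurent_ev.
  by exists (ev t w'); [exact: laurent_ev | rewrite -evM ww' rmorph1].
elim: s ps => [|q s IHs] ps.
  by rewrite big_nil; apply/prime_factorable_unit/(unit_in1 subL).
rewrite big_cons; apply: (prime_factorableM subL).
  case: (ev_prime (ps q (mem_head _ _))); first exact: prime_factorable_unit.
  exact: prime_factorable_prime.
by apply: IHs => r rs; apply: ps; rewrite in_cons rs orbT.
Qed.

(** * Weight gradings on a Laurent ring *)

Section Weights.
Variable l : 'I_(m + n) -> int.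
Implicit Types (S : int -> Prop) (u v : 'X_{1..m + n}) (f g : F).

Definition wt u : int := \sum_i l i * (u i)%:Z.

Lemma wtD u v : wt (u + v)%MM = wt u + wt v.
Proof. by rewrite /wt -big_split; apply: eq_bigr => i _; rewrite mnmDE PoszD mulrDr. Qed.

(** All monomials of [f] have their weight in [S], read off some presentation with a monomial
    denominator. The predicate covers homogeneous elements ([eq d]) as well as bounds on either
    side; zero satisfies it for every [S]. *)
Definition weighted S f := exists u p,
  f * ev t 'X_[u] = ev t p /\ forall v, v \in msupp p -> S (wt v - wt u).

Lemma weighted_laurent S f : weighted S f -> L f.
Proof. by case=> u [p [e _]]; apply/(laurentP free_t); exists u, p. Qed.

Lemma weighted_sub S S' f : (forall d, S d -> S' d) -> weighted S f -> weighted S' f.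
Proof. by move=> SS' [u [p [e sp]]]; exists u, p; split=> // v /sp/SS'. Qed.

Lemma msuppMX_wt (p : W) u v : v \in msupp (p * 'X_[u]) ->
  exists2 w, w \in msupp p & wt v = wt w + wt u.
Proof.
move/msuppM_le/allpairsP => -[[w x] /= [wp]]; rewrite msuppX mem_seq1 => /eqP -> ->.
by exists w => //; rewrite wtD.
Qed.

Lemma weightedD S f g : weighted S f -> weighted S g -> weighted S (f + g).
Proof.
move=> [u [p [ep sp]]] [v [q [eq sq]]].
exists (u + v)%MM, (p * 'X_[v] + q * 'X_[u]); split.
  by rewrite evXD evD !evM -ep -eq; ring.
move=> w /msuppD_le; rewrite mem_cat wtD => /orP[] /msuppMX_wt[x].
  by move/sp => + ->; congr (S _); ring.
by move/sq => + ->; congr (S _); ring.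
Qed.

Lemma weightedN S f : weighted S f -> weighted S (- f).
Proof.
move=> [u [p [ep sp]]]; exists u, (- p); split; first by rewrite rmorphN -ep mulNr.
by move=> v; rewrite (perm_mem (msuppN _)); apply: sp.
Qed.

Lemma weightedM S S' S'' f g : (forall a b, S a -> S' b -> S'' (a + b)) ->
  weighted S f -> weighted S' g -> weighted S'' (f * g).
Proof.
move=> SS [u [p [ep sp]]] [v [q [eq sq]]]; exists (u + v)%MM, (p * q); split.
  by rewrite evXD evM -ep -eq mulrACA.
move=> w /msuppM_le/allpairsP => -[[x y] /= [/sp Sx /sq Sy ->]].
by have := SS _ _ Sx Sy; congr (S'' _); rewrite !wtD; ring.
Qed.

Lemma weighted_mon e : weighted (eq (\sum_i l i * e i)) (mon t e).
Proof.
pose u := [multinom absz (pospart (- e i)) | i < m + n].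
pose v := [multinom absz (pospart (e i)) | i < m + n].
exists u, 'X_[v]; split.
  rewrite !evXm -monD //; apply: eq_mon => i; rewrite !mnmE.
  by rewrite !gez0_abs ?pospart_ge0 // -{1}(pospartB (e i)); ring.
move=> w; rewrite msuppX mem_seq1 => /eqP ->; rewrite /wt -sumrB.
apply: eq_bigr => i _; rewrite !mnmE !gez0_abs ?pospart_ge0 //.
by rewrite -mulrBr pospartB.
Qed.

Lemma weighted1 : weighted (eq 0) 1.
Proof.
rewrite -(mon0 t); have := weighted_mon (fun=> 0); congr (weighted (eq _) _).
by rewrite big1 // => i _; rewrite mulr0.
Qed.

Lemma weightedX (d : int) f k : weighted (fun a => d <= a) f ->
  weighted (fun a => d * k%:Z <= a) (f ^+ k).
Proof.
move=> wf; elim: k => [|k IHk].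
  by rewrite expr0; apply: weighted_sub weighted1 => a <-; rewrite mulr0.
rewrite exprS; apply: weightedM wf IHk => a b; rewrite intS mulrDr mulr1; lia.
Qed.

(** Over a common denominator the two presentations have the same numerator, so the weight of any of
    its monomials would lie in both sets. *)
Lemma weighted_disjoint S S' f : (forall a, S a -> S' a -> False) ->
  weighted S f -> weighted S' f -> f = 0.
Proof.
move=> SS [u [p [ep sp]]] [v [q [eq sq]]].
have e : p * 'X_[v] = q * 'X_[u] by apply: evI; rewrite !evM -ep -eq mulrAC.
suff p0 : p = 0 by apply: (mulIf (ev0 u)); rewrite ep p0 rmorph0 mul0r.
apply/eqP; rewrite -msupp_eq0; case E: (msupp p) => [//|w s]; exfalso.
have wp : w \in msupp p by rewrite E mem_head.
have : (w + v)%MM \in msupp (p * 'X_[v]).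
  by rewrite mcoeff_msupp addmC mcoeffMX -mcoeff_msupp.
rewrite e => /msuppMX_wt[x xq]; rewrite wtD => ex; apply: (SS (wt w - wt u)); first exact: sp.
by have := sq x xq; congr (S' _); lia.
Qed.

Lemma weighted_split (d : int) f : L f -> exists f1 f2,
  [/\ f = f1 + f2, weighted (fun a => a <= d) f1 & weighted (fun a => d < a) f2].
Proof.
case/(laurentP free_t) => u [p ep].
pose low (v : 'X_{1..m + n}) := wt v - wt u <= d.
pose part (Q : pred 'X_{1..m + n}) : W := \sum_(v <- msupp p | Q v) p@_v *: 'X_[v].
have spart Q v : v \in msupp (part Q) -> Q v.
  move/msupp_sum_le/flattenP => -[s /mapP[w]]; rewrite mem_filter => /andP[Qw _] ->.
  by move/msuppZ_le; rewrite msuppX mem_seq1 => /eqP ->.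
have ws S (Q : pred 'X_{1..m + n}) : (forall v, Q v -> S (wt v - wt u)) ->
    weighted S (ev t (part Q) * mon t (fun i => - (u i)%:Z)).
  move=> QS; exists u, (part Q); split; last by move=> v /spart/QS.
  by rewrite monN // -evXm divfK.
exists (ev t (part low) * mon t (fun i => - (u i)%:Z)).
exists (ev t (part (predC low)) * mon t (fun i => - (u i)%:Z)); split.
- rewrite (laurent_frac ep) -mulrDl -evD; congr (ev t _ * _).
  by rewrite {1}[p]mpolyE (bigID low).
- exact: ws.
- by apply: ws => v /=; rewrite /low -ltNge.
Qed.

Lemma weighted_bounded f : L f -> exists d : nat,
  weighted (fun a => - d%:Z <= a /\ a <= d%:Z) f.
Proof.
case/(laurentP free_t) => u [p ep].
exists (\max_(v <- msupp p) `|wt v - wt u|%N); exists u, p; split=> // v vp.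
have : (`|wt v - wt u| <= \max_(x <- msupp p) `|wt x - wt u|)%N.
  by apply: (leq_bigmax_seq (F := fun x => `|wt x - wt u|%N)).
move: (\max_(x <- msupp p) _) => d; lia.
Qed.

(** Formally [q = Q * p * (1 - h + h ^+ 2 - ...)]. Since [Q] is homogeneous of weight 0 and [q]
    lives in a bounded range of weights, the part of the series of weight at most that bound is
    already the quotient. *)
Lemma weighted_coprime Q h p q : weighted (eq 0) Q -> weighted (fun a => 1 <= a) h ->
  L p -> L q -> Q * p = (1 + h) * q -> divides_in L Q q.
Proof.
move=> wQ wh Lp Lq e; have Lh := weighted_laurent wh.
have [d wq] := weighted_bounded Lq.
have step M : exists2 pM, L pM & q = Q * pM + (- h) ^+ M * q.
  elim: M => [|M [pM LpM eM]].
    by exists 0; [exact: (subring0 subL) | rewrite mulr0 add0r expr0 mul1r].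
  exists (pM + (- h) ^+ M * p).
    apply: (subringD subL LpM); apply: (subringM subL) => //.
    exact/(subringX subL)/(subringN subL).
  have eq : q = Q * p - h * q by rewrite e; ring.
  rewrite {1}eM exprS; move: ((- h) ^+ M) => H.
  by rewrite {1}eq; ring.
(* The weights of [q] lie between [-d] and [d], and those of [(- h) ^+ M] are at least [M]; with
   [M = 2d + 1] the error term lies strictly above [d]. So [q - Q * p1] has only weights at most
   [d], and only weights above [d]. *)
have [pM LpM eM] := step (d + d).+1.
have [p1 [p2 [ep w1 w2]]] := weighted_split d%:Z LpM.
exists p1; first exact: weighted_laurent w1.
apply/eqP; rewrite -subr_eq0; apply/eqP.
apply: (@weighted_disjoint (fun a => a <= d%:Z) (fun a => d%:Z < a)).
- by move=> a; lia.
- apply: weightedD; first by apply: weighted_sub wq => a [].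
  by apply: weightedN; apply: weightedM wQ w1 => a b <-; rewrite add0r.
- have -> : q - Q * p1 = Q * p2 + (- h) ^+ (d + d).+1 * q.
    by rewrite {1}eM ep; move: ((- h) ^+ _) => H; ring.
  apply: weightedD; first by apply: weightedM wQ w2 => a b <-; rewrite add0r.
  apply: weightedM (weightedX _ (weightedN wh)) wq => a b; lia.
Qed.

End Weights.
End Localization.

(** * Mutations *)

Section SkewSymmetrizable.
Variables (n : nat) (B : 'M[int]_n).
Hypothesis skewB : skew_symmetrizable B.

Lemma skew_symmetrizableE : exists2 d : 'I_n -> int,
  forall i, 0 < d i & forall i j, d i * B i j = - (d j * B j i).
Proof.
case: skewB => d d0 e; exists (fun i => d 0 i) => // i j.
have /matrixP/(_ j i) := e; rewrite !mxE.
rewrite (bigD1 i) //= big1 ?addr0 => [|x /negbTE xi]; last by rewrite mxE eq_sym xi mulr0n mul0r.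
rewrite (bigD1 j) //= big1 ?addr0 => [|x /negbTE xi]; last by rewrite mxE eq_sym xi mulr0n mul0r.
by rewrite !mxE !eqxx !mulr1n.
Qed.

Lemma skew_diag i : B i i = 0.
Proof.
have [d d0 /(_ i i) e] := skew_symmetrizableE.
have : d i * B i i = 0 by lia.
by move/eqP; rewrite mulf_eq0 gt_eqF //= => /eqP.
Qed.

Lemma skew_eq0 i j : B i j = 0 -> B j i = 0.
Proof.
have [d d0 /(_ i j)] := skew_symmetrizableE => + e; rewrite e mulr0.
move/eqP; rewrite eq_sym oppr_eq0 mulf_eq0 gt_eqF //= => /eqP //.
Qed.

Lemma skew_gt0 i j : 0 < B i j -> B j i < 0.
Proof.
have [d d0 /(_ i j) e] := skew_symmetrizableE => b0.
have : 0 < d i * B i j by rewrite mulr_gt0.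
by rewrite e oppr_gt0 pmulr_rlt0.
Qed.

Lemma skew_lt0 i j : B i j < 0 -> 0 < B j i.
Proof.
have [d d0 /(_ i j) e] := skew_symmetrizableE => b0.
have : d i * B i j < 0 by rewrite pmulr_rlt0.
by rewrite e oppr_lt0 pmulr_rgt0.
Qed.

End SkewSymmetrizable.

Section Mutation.
Variables (K : idomainType) (m n : nat).
Local Notation F := (ambient K m n).
Local Notation preseed := (preseed K m n).
Implicit Types (t : preseed) (k j : 'I_n) (e : 'I_(m + n) -> int).

(** The classical y-hat: the coefficient [X_k] times the product of the [A_j ^ b_jk]. *)
Definition yhat t k : F := mon t (ext t k).

(** Dividing [X_k] and 1 by the tropical sum of 1 and [X_k] leaves the positive and negative parts
    of the exponent vector, so both terms of the binomial are monomials without a common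
    variable. *)
Lemma exchange_binomialE t k : exchange_binomial t k =
  mon t (fun i => pospart (ext t k i)) + mon t (fun i => pospart (- ext t k i)).
Proof.
rewrite /exchange_binomial /mon !big_split_ord /=; congr (_ * _ + _ * _).
- by apply: eq_bigr => a _; rewrite vars_l ext_l !mxE pospart_min.
- rewrite big_mkcond; apply: eq_bigr => j _; rewrite vars_r ext_r.
  by case: ltP => b0; [congr (_ ^ _) | rewrite -[LHS](expr0z (cluster t j)); congr (_ ^ _)];
    rewrite /pospart; lia.
- by apply: eq_bigr => a _; rewrite vars_l ext_l !mxE pospartN_min.
- rewrite big_mkcond; apply: eq_bigr => j _; rewrite vars_r ext_r.
  by case: ltP => b0; [congr (_ ^ _) | rewrite -[LHS](expr0z (cluster t j)); congr (_ ^ _)];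
    rewrite /pospart; lia.
Qed.

Lemma exchange_binomial_yhat t k : free_generating (cluster t) ->
  exchange_binomial t k = mon t (fun i => pospart (- ext t k i)) * (1 + yhat t k).
Proof.
move=> free_t; rewrite exchange_binomialE mulrDr mulr1 addrC; congr (_ + _).
by rewrite -monD //; apply: eq_mon => i; rewrite -{3}(pospartB (ext t k i)); ring.
Qed.

Lemma vars_mut t k i : i != rshift m k -> vars (mutation k t) i = vars t i.
Proof.
elim/ord_split_ind: i => [a|j]; first by rewrite !vars_l.
by rewrite eq_rshift !vars_r /= ffunE => /negbTE ->.
Qed.

Lemma vars_mut_k t k : vars (mutation k t) (rshift m k) =
  (vars t (rshift m k))^-1 * exchange_binomial t k.
Proof. by rewrite !vars_r /= ffunE eqxx. Qed.

Lemma ext_mut_k t k i : ext (mutation k t) k i = - ext t k i.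
Proof.
elim/ord_split_ind: i => [a|j]; first by rewrite !ext_l /= ffunE eqxx mxE.
by rewrite !ext_r /= mxE eqxx orbT.
Qed.

Lemma ext_mut t k j i : j != k -> ext (mutation k t) j i =
  if i == rshift m k then - exmx t k j
  else ext t j i + ext t k i * pospart (exmx t k j) + pospart (- ext t k i) * exmx t k j.
Proof.
move=> jk; elim/ord_split_ind: i => [a|i].
  rewrite eq_lrshift.
  have mz (A : 'rV[int]_m) (z : int) : (A *~ z) 0 a = A 0 a * z.
    case: z => x; first by rewrite -pmulrn mulmxnE -mulr_natr natz.
    by rewrite NegzE mulrNz -pmulrn !mxE mulmxnE -mulr_natr natz mulrN.
  rewrite !ext_l /= ffunE (negbTE jk) !mxE !mz !mxE -pospartN_min /pospart; ring.
rewrite eq_rshift !ext_r /= mxE (negbTE jk) orbF; case: eqP => [-> //|_].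
by rewrite sg_max_mul addrA.
Qed.


Lemma mon_split_seed t e i :
  mon t e = mon t (fun x => if x == i then 0 else e x) * vars t i ^ e i.
Proof.
rewrite /mon (bigD1 i) //= [in RHS](bigD1 i) //= eqxx expr0z mul1r mulrC.
by congr (_ * _); apply: eq_bigr => j /negbTE ->.
Qed.

Lemma mon_mut0 t k e : e (rshift m k) = 0 -> mon (mutation k t) e = mon t e.
Proof.
move=> ek; apply: eq_bigr => i _; have [->|ik] := eqVneq i (rshift m k).
  by rewrite ek !expr0z.
by rewrite vars_mut.
Qed.

Lemma mon_mut t k e : mon (mutation k t) e =
  mon t (fun x => if x == rshift m k then 0 else e x)
  * ((vars t (rshift m k))^-1 * exchange_binomial t k) ^ e (rshift m k).
Proof.
rewrite [LHS](mon_split_seed _ _ (rshift m k)).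
rewrite vars_mut_k [X in X * _ = _]mon_mut0; first exact: erefl.
by rewrite eqxx.
Qed.

(* The quantities [yhat] mutate like the coefficients, with the addition of the
   field in place of the tropical one. *)
Lemma yhat_mut t k j : free_generating (cluster t) -> skew_symmetrizable (exmx t) ->
  j != k -> yhat (mutation k t) j =
  yhat t j * yhat t k ^ pospart (exmx t k j) * (1 + yhat t k) ^ (- exmx t k j).
Proof.
move=> free_t skew_t jk; set b := exmx t k j.
have Ek : ext (mutation k t) j (rshift m k) = - b by rewrite ext_mut // eqxx.
rewrite [LHS]mon_mut Ek.
rewrite exchange_binomial_yhat; last exact: free_t.
rewrite mulrA !expfzMl mulrA; congr (_ * _).
rewrite /yhat -exprN1 exprz_exp mulN1r opprK -mon_vars // -!monX // -!monD //.
apply: eq_mon => i; case: eqP => [->|/eqP ik].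
  by rewrite !ext_r (skew_diag skew_t) -/b oppr0 /pospart; lia.
by rewrite ext_mut // (negbTE ik) -/b; ring.
Qed.

Definition independent_columns t := forall c : 'I_n -> int,
  (forall i, \sum_k c k * ext t k i = 0) -> forall k, c k = 0.

Lemma full_rank_independent t : full_rank t -> independent_columns t.
Proof.
rewrite /full_rank => rk c c0 k.
pose M := map_mx (intr : int -> rat) (extended_exmx t).
have freeM : row_free M^T by rewrite /row_free mxrank_tr rk.
have : \row_j (c j)%:~R *m M^T = 0.
  apply/rowP => i; rewrite mxE [RHS]mxE.
  transitivity ((\sum_j c j * extended_exmx t i j)%:~R : rat).
    by rewrite rmorph_sum; apply: eq_bigr => j _;
      rewrite [(\row__ _) _ _]mxE [M^T _ _]mxE mxE /= intrM.
  rewrite -[i]splitK /extended_exmx; case: (split i) => a /=.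
    rewrite (eq_bigr (fun j => c j * ext t j (rshift m a))).
      by rewrite c0.
    by move=> j _; rewrite col_mxEu ext_r.
  rewrite (eq_bigr (fun j => c j * ext t j (lshift n a))).
    by rewrite c0.
  by move=> j _; rewrite col_mxEd ext_l mxE.
move/eqP; rewrite -(mul0mx _ M^T) => /eqP/(row_free_inj freeM)/rowP/(_ k).
by rewrite !mxE => /eqP; rewrite intr_eq0 => /eqP.
Qed.

Lemma independent_mut t k : skew_symmetrizable (exmx t) ->
  independent_columns t -> independent_columns (mutation k t).
Proof.
move=> skew_t ind c c0.
pose b j := exmx t k j.
have bk : b k = 0 by apply: skew_diag.
have cb : \sum_j c j * b j = 0.
  have := c0 (rshift m k); rewrite (eq_bigr (fun j => - (c j * b j))).
    by rewrite sumrN => /eqP; rewrite oppr_eq0 => /eqP.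
  move=> j _; have [->|jk] := eqVneq j k.
    by rewrite ext_mut_k ext_r -/(b k) bk !(mulr0, oppr0).
  by rewrite ext_mut // eqxx mulrN.
(* Outside row [k], a new column [j] is the old one plus [pospart (b j)] times column [k] plus [b j]
   times a vector independent of [j]. Row [k] of the relation says that the [c j * b j] sum to 0,
   which removes the last contribution; [c'] collects the rest, new column [k] being the opposite of
   the old one. *)
pose c' j := if j == k then \sum_(x | x != k) c x * pospart (b x) - c k else c j.
have c'0 : forall j, c' j = 0.
  apply: ind => i; rewrite (bigD1 k) //= {1}/c' eqxx.
  have := c0 i; rewrite (bigD1 k) //= ext_mut_k.
  rewrite (bigD1 k) //= bk mulr0 add0r in cb.
  have [->|ik] := eqVneq i (rshift m k).
    move=> _; rewrite ext_r skew_diag // mulr0 add0r -[RHS]cb.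
    by apply: eq_bigr => j /negbTE jk; rewrite /c' jk ext_r.
  rewrite (eq_bigr (fun j => c' j * ext t j i + c j * pospart (b j) * ext t k i
     + c j * b j * pospart (- ext t k i))); last first.
    by move=> j jk; rewrite ext_mut // (negbTE ik) /c' (negbTE jk) -/(b j); ring.
  rewrite !big_split -!mulr_suml cb mul0r /= => h; rewrite -[RHS]h; ring.
have cn j : j != k -> c j = 0 by move=> jk; have := c'0 j; rewrite /c' (negbTE jk).
move=> j; have [->|/cn //] := eqVneq j k.
have := c'0 k; rewrite /c' eqxx big1 ?add0r => [/eqP|x xk].
  by rewrite oppr_eq0 => /eqP.
by rewrite cn // mul0r.
Qed.

Lemma independent_functional t k1 k2 : independent_columns t -> k1 != k2 ->
  exists l : 'I_(m + n) -> int,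
    \sum_i l i * ext t k2 i = 0 /\ 0 < \sum_i l i * ext t k1 i.
Proof.
move=> ind k12; pose v := ext t k2; pose w := ext t k1.
have [i vi] : exists i, v i != 0.
  apply: NNPP => no; suff h : forall i, \sum_k (k == k2)%:R * ext t k i = 0.
    by have := ind _ h k2; rewrite eqxx.
  move=> i; rewrite (bigD1 k2) //= eqxx mul1r big1 ?addr0 => [|j /negbTE ->].
    by apply/eqP/negbNE/negP => vi; apply: no; exists i.
  by rewrite mul0r.
have [j vw] : exists j : 'I_(m + n), v i * w j - v j * w i != 0.
  apply: NNPP => no.
  pose c k := if k == k1 then v i else if k == k2 then - w i else 0.
  suff h : forall x, \sum_k c k * ext t k x = 0.
    by have := ind _ h k1; rewrite /c eqxx => /eqP; apply/negP.
  move=> x; rewrite (bigD1 k1) //= (bigD1 k2) 1?eq_sym //= {1 2}/c !eqxx.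
  rewrite [k2 == k1]eq_sym (negbTE k12) big1 ?addr0; last first.
    by move=> y /andP[/negbTE y1 /negbTE y2]; rewrite /c y1 y2 mul0r.
  apply/eqP; rewrite mulNr [w i * _]mulrC; apply/negbNE/negP => ne.
  by apply: no; exists x.
(* The functional is the 2 by 2 minor on rows [i], [j] with column [k2], so it vanishes on that
   column; [s] makes its value on column [k1] positive. *)
pose s : int := if 0 < v i * w j - v j * w i then 1 else -1.
exists (fun x => s * ((if x == j then v i else 0) - (if x == i then v j else 0))).
have sumE (f : 'I_(m + n) -> int) :
    \sum_x s * ((if x == j then v i else 0) - (if x == i then v j else 0)) * f x
    = s * (v i * f j - v j * f i).
  transitivity (s * (\sum_x (if x == j then v i * f x else 0)
    - \sum_x (if x == i then v j * f x else 0))).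
    by rewrite -sumrB mulr_sumr; apply: eq_bigr => x _; case: eqP; case: eqP => _ _; ring.
  by rewrite -!big_mkcond !big_pred1_eq.
rewrite !sumE -/v -/w; split; first by rewrite [v j * _]mulrC subrr mulr0.
rewrite /s; have [lt0D|le] := ltP 0 (v i * w j - v j * w i); first by rewrite mul1r.
by rewrite mulN1r oppr_gt0 lt_neqAle vw.
Qed.

End Mutation.

Lemma ev_subring (K : idomainType) (m n : nat) (t : preseed K m n) (S : ambient K m n -> Prop) :
  subring S -> (forall c, S (@Defs.scalar K m n c)) -> (forall i, S (vars t i)) ->
  forall p, S (ev t p).
Proof.
move=> subS Sc Sv; elim/mpoly_gen_ind => [c|i|p q Sp Sq|p q Sp Sq].
- by rewrite evC.
- by rewrite evX.
- by rewrite rmorphD; apply: (subringD subS).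
- by rewrite rmorphM; apply: (subringM subS).
Qed.

(** * Monomials times one plus terms of positive weight *)

Section OnePlus.
Variables (K : idomainType) (m n : nat) (t : preseed K m n) (l : 'I_(m + n) -> int).
Local Notation F := (ambient K m n).
Hypothesis free_t : free_generating (cluster t).
Implicit Types f g h u R : F.

Definition one_plus f := exists2 h, weighted t l (fun a => 1 <= a) h & f = 1 + h.

Definition monomial_one_plus f := exists e R, one_plus R /\ f = mon t e * R.

Lemma weighted0 S : weighted t l S 0.
Proof. by exists 0%MM, 0; split=> [|v]; rewrite ?rmorph0 ?mul0r // msupp0. Qed.

Lemma weighted_ge0 f : one_plus f -> weighted t l (fun a => 0 <= a) f.
Proof.
case=> h wh ->; apply: weightedD.
  by apply: weighted_sub (weighted1 _ _ ) => // a <-.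
by apply: weighted_sub wh => a; lia.
Qed.

Lemma one_plus1 : one_plus 1.
Proof. by exists 0; [exact: weighted0 | rewrite addr0]. Qed.

Lemma one_plusM f g : one_plus f -> one_plus g -> one_plus (f * g).
Proof.
move=> [h wh ef] og; have wg := weighted_ge0 og; case: og => h' wh' eg.
exists (h * g + h'); last by rewrite ef eg; ring.
by apply: weightedD wh'; apply: weightedM wh wg => a b; lia.
Qed.

Lemma one_plusX f k : one_plus f -> one_plus (f ^+ k).
Proof.
move=> of1; elim: k => [|k IHk]; first by rewrite expr0; apply: one_plus1.
by rewrite exprS; apply: one_plusM.
Qed.

Lemma monomial_one_plus_mon e : monomial_one_plus (mon t e).
Proof. by exists e, 1; split; [exact: one_plus1 | rewrite mulr1]. Qed.

Lemma monomial_one_plusM f g :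
  monomial_one_plus f -> monomial_one_plus g -> monomial_one_plus (f * g).
Proof.
case=> e [R [oR ->]] [e' [R' [oR' ->]]]; exists (fun i => e i + e' i), (R * R').
by split; [exact: one_plusM | rewrite monD; [rewrite mulrACA | exact: free_t]].
Qed.

Lemma monomial_one_plusX f k : monomial_one_plus f -> monomial_one_plus (f ^+ k).
Proof.
move=> mf; elim: k => [|k IHk].
  by rewrite expr0 -(mon0 t); apply: monomial_one_plus_mon.
by rewrite exprS; apply: monomial_one_plusM.
Qed.

Lemma one_plus_monomial f : one_plus f -> monomial_one_plus f.
Proof. by move=> of1; exists (fun=> 0), f; split; rewrite // mon0 mul1r. Qed.

Lemma one_plus_laurent f : one_plus f -> laurent t f.
Proof. by move/weighted_ge0/weighted_laurent; apply. Qed.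

Lemma monomial_one_plus_laurent f : monomial_one_plus f -> laurent t f.
Proof.
case=> e [R [oR ->]]; apply: (subringM (laurent_subring t)).
  exact: laurent_mon.
exact: one_plus_laurent.
Qed.

(* If [ka] has positive weight and [u] has weight zero, then modulo [u] the
   element [R = 1 + ka u ^ g.+1] is [1]; dividing [R ^ b + (u - 1)] and
   [1 + (u - 1) R ^ b] by [u] leaves [1] plus terms of positive weight. *)
Lemma one_plus_division (ka u : F) (g b : nat) (R := 1 + ka * u ^+ g.+1) :
  weighted t l (fun a => 1 <= a) ka -> weighted t l (eq 0) u ->
  [/\ one_plus R,
    exists2 R', one_plus R' & R ^+ b + (u - 1) = u * R'
    & exists2 R', one_plus R' & 1 + (u - 1) * R ^+ b = u * R'].
Proof.
move=> wka wu.
have wuX k : weighted t l (fun a => 0 <= a) (u ^+ k).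
  have wu0 : weighted t l (fun a => 0 <= a) u by apply: weighted_sub wu => a <-.
  by apply: weighted_sub (weightedX free_t k wu0) => a; rewrite mul0r.
have oR : one_plus R.
  by exists (ka * u ^+ g.+1) => //; apply: weightedM wka (wuX _) => a c; lia.
pose G := \sum_(i < b) R ^+ i.
have wG : weighted t l (fun a => 0 <= a) G.
  apply: (big_ind (weighted t l (fun a => 0 <= a))) => [|f h wf wh|i _].
  - exact: weighted0.
  - exact: weightedD.
  - exact/weighted_ge0/one_plusX.
have eG : R ^+ b = 1 + ka * u ^+ g.+1 * G.
  have := subrX1 R b; rewrite -/G {2}/R => e.
  by rewrite -[LHS](subrK 1) e; ring.
have w1 : weighted t l (fun a => 1 <= a) (ka * u ^+ g * G).
  apply: weightedM (_ : weighted t l (fun a => 1 <= a) _) wG => [a c|]; first by lia.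
  by apply: weightedM wka (wuX _) => a c; lia.
split=> //.
- exists (1 + ka * u ^+ g * G); first by exists (ka * u ^+ g * G).
  by rewrite eG exprS; ring.
- have w2 : weighted t l (fun a => 1 <= a) (ka * u ^+ g.+1 * G).
    apply: weightedM (_ : weighted t l (fun a => 1 <= a) _) wG => [a c|]; first by lia.
    by apply: weightedM wka (wuX _) => a c; lia.
  exists (1 + (ka * u ^+ g.+1 * G - ka * u ^+ g * G)).
    exists (ka * u ^+ g.+1 * G - ka * u ^+ g * G) => //.
    by apply: weightedD => //; apply: weightedN.
  by rewrite eG exprS; ring.
Qed.

End OnePlus.

(** * The rank two argument *)

Section FieldIdentities.
Variable F : fieldType.
Implicit Types x y z : F.

Lemma expf_quotient x y (k : nat) : x != 0 ->
  (x^-1) ^ k%:Z * ((y / x) ^ k%:Z)^-1 = (y ^+ k)^-1.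
Proof.
move=> x0; rewrite -!exprnP exprMn exprVn invfM invrK.
by rewrite mulrCA mulVf ?mulr1 // expf_neq0.
Qed.

Lemma clear_denominator x y z t : z != 0 ->
  x * (y * z) * (1 + t * z^-1) = x * y * (z + t).
Proof. by move=> z0; field. Qed.

End FieldIdentities.

Section RankTwo.
Variables (K : idomainType) (m n : nat) (s : preseed K m n) (k1 k2 : 'I_n).
Local Notation F := (ambient K m n).
Let s1 := mutation k1 s.
Let s2 := mutation k2 s.
Let s12 := mutation k2 s1.
Hypothesis k12 : k1 != k2.
Hypothesis free_s : free_generating (cluster s).
Hypothesis free_s1 : free_generating (cluster s1).
Hypothesis free_s2 : free_generating (cluster s2).
Hypothesis free_s12 : free_generating (cluster s12).
Hypothesis skew_s : skew_symmetrizable (exmx s).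
Hypothesis skew_s1 : skew_symmetrizable (exmx s1).
Hypothesis ind_s : independent_columns s.
Let i1 : 'I_(m + n) := rshift m k1.
Let i2 : 'I_(m + n) := rshift m k2.
Let b := exmx s k1 k2.
Let c := exmx s k2 k1.
Let u : F := 1 + yhat s k2.
Let subL2 := laurent_subring s2.

Let i12 : i1 != i2. Proof. by rewrite eq_rshift. Qed.
Let i21 : i2 != i1. Proof. by rewrite eq_sym. Qed.

Lemma u_neq0 : u != 0.
Proof.
apply/eqP => u0; have := vars_neq0 free_s2 i2.
rewrite vars_mut_k exchange_binomial_yhat; last exact: free_s.
by rewrite -/u u0 !mulr0 eqxx.
Qed.

Let ext22 : ext s k2 i2 = 0. Proof. by rewrite ext_r skew_diag. Qed.

(** Only the variable at [i2] changes, and it is [u] times a monomial of [s2] in which [vars s2 i2]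
    has exponent -1. That exponent is recorded because [rank_two_nonzero] grades by it. *)
Lemma mon_s_s2 e : exists2 e', e' i2 = - e i2 & mon s e = mon s2 e' * u ^ e i2.
Proof.
exists (fun x => if x == i2 then - e i2 else e x + pospart (- ext s k2 x) * e i2).
  by rewrite eqxx.
have x2E : vars s i2 = mon s2 (fun x => pospart (- ext s k2 x)) * u * (vars s2 i2)^-1.
  rewrite mon_mut0; last by rewrite ext22.
  rewrite /u -exchange_binomial_yhat; last exact: free_s.
  have := vars_mut_k s k2; rewrite -/s2 -/i2 => e2.
  apply: (mulIf (vars_neq0 free_s2 i2)); rewrite mulfVK ?(vars_neq0 free_s2 i2) // e2.
  by rewrite mulVKf // (vars_neq0 free_s).
rewrite [LHS](mon_split_seed _ _ i2) x2E.
have -> : mon s (fun x => if x == i2 then 0 else e x) =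
    mon s2 (fun x => if x == i2 then 0 else e x) by rewrite mon_mut0 // eqxx.
rewrite !expfzMl -monX; last exact: free_s2.
rewrite -exprN1 exprz_exp -mon_vars.
rewrite [X in _ * X = _]mulrAC mulrA -!monD; try exact: free_s2.
congr (_ * _); apply: eq_mon => i; case: eqP => [->|_].
  by rewrite ext22 /pospart; lia.
by rewrite addr0.
Qed.

Lemma mon_s_s2_0 e : e i2 = 0 -> mon s e = mon s2 e.
Proof. by move=> e0; rewrite mon_mut0. Qed.

Lemma u_laurent : laurent s2 u.
Proof.
apply: (subringD subL2); first exact: (subring1 subL2).
by rewrite /yhat mon_s_s2_0 //; apply: laurent_mon.
Qed.

Lemma vars_s_laurent i : laurent s2 (vars s i).
Proof.
rewrite -[vars s i]expr1z -(mon_vars s i 1).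
have [e' _ ->] := mon_s_s2 (fun x => if x == i then 1 else 0).
apply: (subringM subL2); first exact: laurent_mon.
case: eqP => _; last by rewrite expr0z; apply: (subring1 subL2).
by rewrite expr1z; apply: u_laurent.
Qed.

Lemma scalar_laurent t (a : K) : laurent t (@Defs.scalar K m n a).
Proof. by apply: laurent_KP; apply: KP_scalar. Qed.

Lemma laurent_s_s2 f : laurent s f -> exists N, laurent s2 (f * u ^+ N).
Proof.
case/(laurentP free_s) => v [p ep].
have [e' _ e] := mon_s_s2 (fun x => (v x)%:Z).
exists (v i2); rewrite evXm e in ep.
have -> : f * u ^+ v i2 = ev s p * mon s2 (fun x => - e' x).
  rewrite -ep monN; last exact: free_s2.
  by rewrite [mon s2 e' * _]mulrC mulrA mulfK // (mon_neq0 free_s2).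
apply: (subringM subL2); last exact: laurent_mon.
apply: (ev_subring subL2) => [a|i]; [exact: scalar_laurent | exact: vars_s_laurent].
Qed.

Lemma vars_s12 i : i != i1 -> i != i2 -> vars s12 i = vars s2 i.
Proof. by move=> h1 h2; rewrite vars_mut // vars_mut // [RHS]vars_mut. Qed.

Lemma vars_s12_1 : vars s12 i1 = vars s1 i1.
Proof. by rewrite vars_mut. Qed.

Lemma vars_s12_2 : vars s12 i2 = (vars s i2)^-1 * exchange_binomial s1 k2.
Proof. by rewrite vars_mut_k (vars_mut _ i21). Qed.

Section Weight.
Variable l : 'I_(m + n) -> int.
Hypothesis wu : weighted s2 l (eq 0) u.
Hypothesis m1 : monomial_one_plus s2 l (vars s12 i1).
Hypothesis m2 : monomial_one_plus s2 l (vars s12 i2).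

Lemma vars_s12_monomial i : monomial_one_plus s2 l (vars s12 i).
Proof.
have [->|h1] := eqVneq i i1; first exact: m1.
have [->|h2] := eqVneq i i2; first exact: m2.
rewrite vars_s12 // -[vars s2 i]expr1z -(mon_vars s2 i 1).
exact: monomial_one_plus_mon.
Qed.

(** Clearing denominators from [s] and from [s12] puts [f * u ^+ N] and [f * R] into [L(s2)], with
    [R] of the form [1 + h]. Coprimality of [u ^+ N] and [R] then makes [u ^+ N] divide [f * u ^+ N]
    there. *)
Lemma rank_two_weight f : laurent s f -> laurent s12 f -> laurent s2 f.
Proof.
move=> /laurent_s_s2[N Lq] /(laurentP free_s12)[v [p ep]].
have : monomial_one_plus s2 l (ev s12 'X_[v]).
  rewrite evXm; apply: (big_ind (monomial_one_plus s2 l)) => [|g h|i _].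
  - by apply: one_plus_monomial; apply: one_plus1.
  - exact: monomial_one_plusM.
  - exact/(monomial_one_plusX free_s2)/vars_s12_monomial.
case=> e [R [[h wh eR] eX]]; rewrite eX in ep.
have LfR : laurent s2 (f * R).
  have -> : f * R = ev s12 p * mon s2 (fun x => - e x).
    rewrite -ep monN; last exact: free_s2.
    by rewrite [mon s2 e * _]mulrC mulrA mulfK // (mon_neq0 free_s2).
  apply: (subringM subL2); last exact: laurent_mon.
  apply: (ev_subring subL2) => [a|i]; first exact: scalar_laurent.
  exact/(monomial_one_plus_laurent free_s2)/vars_s12_monomial.
have wuN : weighted s2 l (eq 0) (u ^+ N).
  elim: N {Lq} => [|N IHN]; first by rewrite expr0; apply: weighted1.
  by rewrite exprS; apply: weightedM wu IHN => a d <- <-.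
have [|r Lr er] := weighted_coprime free_s2 wuN wh LfR Lq.
  by rewrite -eR; ring.
suff -> : f = r by [].
apply: (mulIf (expf_neq0 N u_neq0)); rewrite er; exact: mulrC.
Qed.

End Weight.

Let E := ext s1 k2.

Let E1 : E i1 = - b. Proof. by rewrite /E ext_mut; [rewrite eqxx | rewrite eq_sym]. Qed.

Let E2 : E i2 = 0. Proof. by rewrite /E ext_r skew_diag. Qed.

Lemma weighted_u l : \sum_i l i * ext s k2 i = 0 -> weighted s2 l (eq 0) u.
Proof.
move=> e0; apply: weightedD; first exact: weighted1.
by rewrite /yhat mon_s_s2_0 // -[in X in weighted _ _ X _]e0; apply: weighted_mon.
Qed.

(** Negating the column swaps the two terms of the binomial, so either of them may be factored out;
    [rank_two_nonzero] needs this freedom of sign. *)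
Lemma exchange_binomial_sign e :
  e =1 ext s k1 \/ e =1 (fun i => - ext s k1 i) ->
  exchange_binomial s k1 = mon s (fun i => pospart (- e i)) * (1 + mon s e).
Proof.
have eP (e' : 'I_(m + n) -> int) : mon s (fun i => pospart (- e' i)) * (1 + mon s e') =
    mon s (fun i => pospart (e' i)) + mon s (fun i => pospart (- e' i)).
  rewrite mulrDr mulr1 addrC; congr (_ + _); rewrite -monD; last exact: free_s.
  by apply: eq_mon => i; rewrite /pospart; lia.
rewrite exchange_binomialE eP => -[] ee.
  by congr (_ + _); apply: eq_mon => i; rewrite ee.
by rewrite addrC; congr (_ + _); apply: eq_mon => i; rewrite ee ?opprK.
Qed.

Lemma vars_s12_1_monomial l e R : e i2 = 0 ->
  exchange_binomial s k1 = mon s e * R -> one_plus s2 l R ->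
  exists e', vars s12 i1 = mon s2 e' * R.
Proof.
move=> e0 eP oR; exists (fun x => (if x == i1 then -1 else 0) + e x).
rewrite vars_s12_1 vars_mut_k eP mulrA -mon_s_s2_0; last first.
  by rewrite (negbTE i21) e0.
rewrite monD; last exact: free_s.
by rewrite mon_vars exprN1.
Qed.

Lemma vars_s_i2V : exists e', (vars s i2)^-1 = mon s2 e' * u^-1.
Proof.
rewrite -exprN1 -mon_vars.
have [e' _ ->] := mon_s_s2 (fun x => if x == i2 then -1 else 0).
by exists e'; rewrite eqxx exprN1.
Qed.

(** The inverse of [vars s i2], read in [s2], carries a factor [u^-1], which the factor [u] of the
    binomial cancels. *)
Lemma monomial_one_plus_s12_2 l e R : one_plus s2 l R ->
  exchange_binomial s1 k2 = mon s2 e * (u * R) -> monomial_one_plus s2 l (vars s12 i2).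
Proof.
move=> oR eP; have [e' eV] := vars_s_i2V.
exists (fun x => e' x + e x), R; split=> //.
rewrite vars_s12_2 eP eV monD; last exact: free_s2.
rewrite [LHS](_ : _ = mon s2 e' * mon s2 e * R * (u^-1 * u)); last by ring.
by rewrite mulVf ?u_neq0 // mulr1.
Qed.

Lemma exchange_s1 : exchange_binomial s1 k2 =
  mon s1 (fun i => pospart (- E i)) *
  (1 + (u - 1) * (yhat s k1 ^ pospart b * (1 + yhat s k1) ^ (- b))).
Proof.
rewrite exchange_binomial_yhat; last exact: free_s1.
congr (_ * (1 + _)); rewrite yhat_mut; [| exact: free_s | exact: skew_s | by rewrite eq_sym].
by have -> : u - 1 = yhat s k2; [rewrite /u; ring | rewrite mulrA].
Qed.

Lemma rank_two_zero f : b = 0 -> laurent s f -> laurent s12 f -> laurent s2 f.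
Proof.
move=> b0; have c0 : c = 0 by apply: skew_eq0.
(* Vanishing on column [k2] gives [u] weight 0, and positivity on column [k1] makes [1 + yhat s k1]
   an element [1 + h]. *)
have [l [l2 l1]] := independent_functional ind_s k12.
have e0 : ext s k1 i2 = 0 by rewrite ext_r.
have oR : one_plus s2 l (1 + mon s (ext s k1)).
  exists (mon s (ext s k1)) => //; rewrite mon_s_s2_0 //.
  by apply: weighted_sub (weighted_mon free_s2 _ _) => a <-; lia.
apply: (rank_two_weight (weighted_u l2)).
  have [|e' ->] := vars_s12_1_monomial _ (exchange_binomial_sign (or_introl (fun=> erefl))) oR.
    by rewrite e0.
  by exists e', (1 + mon s (ext s k1)).
apply: (monomial_one_plus_s12_2 (e := fun i => pospart (- E i)) (one_plus1 _ _)).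
rewrite exchange_s1 b0 (_ : pospart 0 = 0) ?oppr0 ?expr0z ?mulr1; last by rewrite /pospart; lia.
rewrite [1 + _]addrC subrK -mon_s_s2_0; last by rewrite E2.
by rewrite mon_mut0 // E1 b0.
Qed.

Lemma rank_two_nonzero f : b != 0 -> laurent s f -> laurent s12 f -> laurent s2 f.
Proof.
(* As [vars s i2] is [u] times a monomial with [vars s2 i2] to the power -1, this sign gives
   monomials of [s] a weight equal to their exponent at [i2]. *)
move=> b0; pose l x : int := if x == i2 then -1 else 0.
have lE (e : 'I_(m + n) -> int) : \sum_i l i * e i = - e i2.
  rewrite (bigD1 i2) //= /l eqxx big1 ?addr0 ?mulN1r // => i /negbTE ->.
  by rewrite mul0r.
have wu : weighted s2 l (eq 0) u by apply: weighted_u; rewrite lE ext22 oppr0.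
(* The sign is chosen so that [e i2 > 0]: by skew-symmetrizability [b] and [c] have opposite
   signs. *)
pose e (x : 'I_(m + n)) : int := if b < 0 then ext s k1 x else - ext s k1 x.
have esign : e =1 ext s k1 \/ e =1 (fun i => - ext s k1 i).
  by rewrite /e; case: (b < 0); [left | right].
have [g eg] : exists g : nat, e i2 = g.+1%:Z.
  have e0 : 0 < e i2.
    rewrite /e ext_r; have [|b1] := ltP b 0; first exact: skew_lt0.
    by rewrite oppr_gt0; apply: skew_gt0 => //; rewrite lt_neqAle eq_sym b0.
  by exists (absz (e i2)).-1; lia.
have [e' e'2 eE] := mon_s_s2 e; rewrite eg in e'2 eE.
pose R := 1 + mon s2 e' * u ^+ g.+1.
have wka : weighted s2 l (fun a => 1 <= a) (mon s2 e').
  by apply: weighted_sub (weighted_mon free_s2 _ _) => a <-; rewrite lE e'2; lia.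
have eR : 1 + mon s e = R by rewrite eE.
(* The second factor of the binomial in [exchange_s1] is [1 + (u - 1) * R ^+ absz b] if [b < 0], and
   [R ^+ absz b + (u - 1)] divided by [R ^+ absz b] if [b > 0]. Hence the two divisions by [u]. *)
have [oR [R1 oR1 eR1] [R2 oR2 eR2]] := one_plus_division free_s2 g (absz b) wka wu.
have p0 : pospart (- e i2) = 0 by rewrite eg /pospart; lia.
have eP := exchange_binomial_sign esign; rewrite eR in eP.
have [e1 ev1] := vars_s12_1_monomial (e := fun i => pospart (- e i)) p0 eP oR.
apply: (rank_two_weight wu); first by exists e1, R.
have [b1|b1] : b < 0 \/ 0 < b by lia.
  have ye : yhat s k1 = mon s e by apply: eq_mon => i; rewrite /e b1.
  apply: (monomial_one_plus_s12_2 (e := fun i => pospart (- E i)) oR2).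
  have pb : pospart b = 0 by rewrite /pospart; lia.
  rewrite exchange_s1 ye eR pb expr0z mul1r (_ : - b = (absz b)%:Z); last by lia.
  rewrite -eR2 -mon_s_s2_0; last by rewrite E2.
  by rewrite mon_mut0 // E1 opprK.
have R0 : R != 0.
  have := vars_neq0 free_s12 i1; rewrite ev1; apply: contraNneq => ->.
  by rewrite mulr0.
have ye : yhat s k1 = (mon s e)^-1.
  rewrite -monN; last exact: free_s.
  by apply: eq_mon => i; rewrite /e ltNge ltW // opprK.
have yR : yhat s k1 ^ pospart b * (1 + yhat s k1) ^ (- b) = (R ^+ absz b)^-1.
  have -> : pospart b = (absz b)%:Z by rewrite /pospart; lia.
  have -> : - b = - (absz b)%:Z by lia.
  rewrite -invr_expz.
  have h0 : mon s e != 0 by apply: mon_neq0; exact: free_s.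
  have -> : 1 + yhat s k1 = R / mon s e.
    by rewrite ye -eR mulrDl mul1r divff // addrC.
  rewrite ye; exact: expf_quotient.
(* The front monomial without its power of [vars s1 i1]. That power has exponent [absz b] and
   contributes the factor [R ^+ absz b] that clears the denominator. *)
pose M x := if x == i1 then 0 else pospart (- E x).
apply: (monomial_one_plus_s12_2 (e := fun x => M x + e1 x * (absz b)%:Z) oR1).
rewrite exchange_s1 yR -eR1 [X in X * _ = _](mon_split_seed _ _ i1).
have -> : pospart (- E i1) = (absz b)%:Z by rewrite E1 /pospart; lia.
rewrite -vars_s12_1 ev1 -exprnP exprMn monD; last exact: free_s2.
rewrite monXn; last exact: free_s2.
have -> : mon s1 M = mon s2 M.
  rewrite -mon_s_s2_0; last by rewrite /M (negbTE i21) E2.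
  by apply: mon_mut0; rewrite /M eqxx.
move: (mon s2 M) (mon s2 e1 ^+ absz b) => x y.
exact: clear_denominator (expf_neq0 _ R0).
Qed.

Lemma rank_two f : laurent s f -> laurent s12 f -> laurent s2 f.
Proof. by have [/rank_two_zero|/rank_two_nonzero] := eqVneq b 0; apply. Qed.

End RankTwo.

(** * Starfish lemma and exchange polynomials *)

Section Tree.
Variable n : nat.
Implicit Types t : tree_vertex n.

Lemma tree_edge_sym k t t' : tree_edge k t t' -> tree_edge k t' t.
Proof. by case; [right | left]. Qed.

Lemma tree_neighbor k t : exists t', tree_edge k t t'.
Proof.
case: t => [[|j w] sw].
  by exists (@TreeVertex n [:: k] isT); left.
have [e|kj] := eqVneq k j.
  by exists (TreeVertex (path_sorted sw)); right; rewrite e.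
have skw : sorted (fun i j => i != j) [:: k, j & w] by rewrite /= kj.
by exists (TreeVertex skw); left.
Qed.

Lemma tree_connected (P : tree_vertex n -> Prop) t0 :
  (forall k t t', tree_edge k t t' -> P t -> P t') -> P t0 -> forall t, P t.
Proof.
move=> Pedge Pt0; pose root := @TreeVertex n [::] isT.
have word_inj t t' : tree_word t = tree_word t' -> t = t'.
  by case: t t' => w sw [w' sw'] /= e; rewrite -e in sw' *; rewrite (bool_irrelevance sw sw').
(* An equivalence with the root can be composed between any two vertices; the implication alone
   could not be reversed. *)
suff rootP t : P root <-> P t by move=> t; apply/rootP/(rootP t0).
case: t => w; elim: w => [|j w IHw] sw; first by have -> : TreeVertex sw = root by apply: word_inj.
have IH := IHw (path_sorted sw).
have edge : tree_edge j (TreeVertex (path_sorted sw)) (TreeVertex sw) by left.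
by split=> [/IH|Pt]; [apply: Pedge edge | apply/IH/(Pedge _ _ _ (tree_edge_sym edge))].
Qed.

End Tree.

(** * From the neighbours of one seed to all seeds *)

Section Pattern.
Variables (K : idomainType) (m n : nat) (Sigma : tree_vertex n -> preseed K m n).
Variable t0 : tree_vertex n.
Hypothesis pattern : seed_pattern Sigma.
Hypothesis rank0 : full_rank (Sigma t0).
Local Notation F := (ambient K m n).
Local Notation U := (upper_cluster_algebra Sigma).
Implicit Types (t : tree_vertex n) (f : F).

Let free t : free_generating (cluster (Sigma t)). Proof. by case: pattern => /(_ t)[]. Qed.
Let skew t : skew_symmetrizable (exmx (Sigma t)). Proof. by case: pattern => /(_ t)[]. Qed.
Let mut k t t' : tree_edge k t t' -> Sigma t' = mutation k (Sigma t).
Proof. by case: pattern => _; apply. Qed.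

Lemma pattern_independent t : independent_columns (Sigma t).
Proof.
move: t; apply: (tree_connected (t0 := t0)); last exact: full_rank_independent.
by move=> k t t' /mut ->; apply: independent_mut.
Qed.

Lemma neighbor_laurent_edge f k t t' : tree_edge k t t' ->
  laurent (Sigma t) f /\ (forall j, laurent (mutation j (Sigma t)) f) ->
  laurent (Sigma t') f /\ (forall j, laurent (mutation j (Sigma t')) f).
Proof.
move=> e [Lt Ltj]; have et := mut e; have et' := mut (tree_edge_sym e).
split=> [|j]; first by rewrite et.
have [->|jk] := eqVneq j k; first by rewrite -et'.
have [t1 /mut e1] := tree_neighbor j t'.
have [t2 /mut e2] := tree_neighbor j t.
(* Seen from [t'], mutating at [k] leads back to [t], so mutating at [k] and then at [j] gives a
   neighbour of [t], where [f] is known to be Laurent. *)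
apply: (@rank_two K m n (Sigma t') k j).
- by rewrite eq_sym.
- exact: free.
- by rewrite -et'; apply: free.
- by rewrite -e1; apply: free.
- by rewrite -et' -e2; apply: free.
- exact: skew.
- by rewrite -et'; apply: skew.
- exact: pattern_independent.
- by rewrite et.
- by rewrite -et'.
Qed.

Lemma upper_cluster_algebraP f : U f <->
  laurent (Sigma t0) f /\ (forall k, laurent (mutation k (Sigma t0)) f).
Proof.
split=> [Uf|nb t].
  by split=> // k; have [t' /mut <-] := tree_neighbor k t0; apply: Uf.
suff [] : laurent (Sigma t) f /\ (forall j, laurent (mutation j (Sigma t)) f) by [].
by move: t; apply: (tree_connected (t0 := t0)) nb => k t t'; apply: neighbor_laurent_edge.
Qed.

End Pattern.

(** * The exchange binomial as a polynomial free of the mutated variable *)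

Section ExchangePolynomial.
Variables (K : idomainType) (m n : nat) (t : preseed K m n) (k : 'I_n).
Local Notation F := (ambient K m n).
Local Notation W := {mpoly K[m + n]}.
Local Notation TW := (@everything W).
Let t' := mutation k t.
Let kk : 'I_(m + n) := rshift m k.
Local Notation P := (exchange_binomial t k).
Local Notation A := (cluster t k).
Local Notation A' := (cluster t' k).
Hypothesis free_t : free_generating (cluster t).
Hypothesis free_t' : free_generating (cluster t').
Hypothesis skew_t : skew_symmetrizable (exmx t).
Hypothesis P_not_invertible : ~ unit_in (@KP K m n) P.
Let subL' := laurent_subring t'.

Definition expos (e : 'I_(m + n) -> int) : 'X_{1..m + n} :=
  [multinom absz (pospart (e i)) | i < m + n].

Definition exchange_poly : W :=
  'X_[expos (ext t k)] + 'X_[expos (fun i => - ext t k i)].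

Let ext_kk : ext t k kk = 0. Proof. by rewrite ext_r skew_diag. Qed.

Lemma ev_exchange_poly : ev t exchange_poly = P.
Proof.
rewrite exchange_binomialE rmorphD !evXm.
by congr (_ + _); apply: eq_mon => i; rewrite mnmE gez0_abs // pospart_ge0.
Qed.

Lemma zapXm i (v : 'X_{1..m + n}) :
  zap i ('X_[v] : W) = if v i == 0%N then 'X_[v] else 0.
Proof.
rewrite mpolyXE_id rmorph_prod (bigD1 i) //= [RHS](_ : _ =
   (if v i == 0%N then 1 else 0) * \prod_(j | j != i) 'X_j ^+ v j).
  congr (_ * _); first by rewrite rmorphXn zapX eqxx expr0n; case: eqP.
  by apply: eq_bigr => j /negbTE ji; rewrite rmorphXn zapX ji.
by case: eqP => [e|_]; rewrite ?mul0r // mul1r (bigD1 i) //= e expr0 mul1r.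
Qed.

Lemma zap_exchange_poly : zap kk exchange_poly = exchange_poly.
Proof. by rewrite rmorphD !zapXm !mnmE ext_kk oppr0. Qed.

Lemma ev_zap p : ev t (zap kk p) = ev t' (zap kk p).
Proof.
apply: (mpoly_rmorph_eq (f := ev t \o zap kk) (g := ev t' \o zap kk) _ _ p) => [c|i] /=.
  by rewrite zapC !evC.
rewrite zapX; case: eqP => [_|/eqP ik]; first by rewrite !rmorph0.
by rewrite !evX vars_mut.
Qed.

Lemma ev_mut_exchange_poly : ev t' exchange_poly = P.
Proof. by rewrite -zap_exchange_poly -ev_zap zap_exchange_poly ev_exchange_poly. Qed.

Lemma cluster_mut : A' = A^-1 * P.
Proof. by have := vars_mut_k t k; rewrite !vars_r. Qed.

Lemma cluster_neq0 : A != 0.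
Proof. by rewrite -vars_r; apply: vars_neq0. Qed.

Lemma cluster_mut_neq0 : A' != 0.
Proof. by rewrite -vars_r; apply: vars_neq0. Qed.

Lemma exchange_binomial_neq0 : P != 0.
Proof.
apply/eqP => P0; move: cluster_mut_neq0; rewrite cluster_mut P0.
by rewrite mulr0 eqxx.
Qed.

(** Each variable occurs in at most one of the two monomials, so setting it to 0 leaves a single
    monomial or the whole non-zero binomial. *)
Lemma exchange_poly_monomial_divisor c v g :
  c%:MP * 'X_[v] * g = exchange_poly -> v = 0%MM.
Proof.
move=> e; apply/mnmP => i; rewrite mnm0E; apply/eqP/negbNE/negP => vi.
have : zap i exchange_poly = 0.
  by rewrite -e !rmorphM zapXm (negbTE vi) mulr0 mul0r.
rewrite rmorphD !zapXm !mnmE.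
have b0 : exchange_poly != 0.
  apply/eqP => b0; move: exchange_binomial_neq0; rewrite -ev_exchange_poly b0.
  by rewrite rmorph0 eqxx.
have [e0|e0] := pospart_eq0 (ext t k i).
- rewrite e0 eqxx; case: eqP => _; first by apply/eqP.
  by rewrite addr0; apply/eqP/mpolyX_neq0.
- rewrite e0 eqxx; case: eqP => _; first by apply/eqP.
  by rewrite add0r; apply/eqP/mpolyX_neq0.
Qed.

(** A unit of the Laurent ring is a scalar unit times a monomial; no variable divides the binomial,
    so it would be a scalar unit, hence invertible in [KP]. *)
Lemma exchange_binomial_nonunit : ~ unit_in (laurent t') P.
Proof.
rewrite -ev_mut_exchange_poly => /(ev_unit free_t')[c [v [uc e]]].
have v0 : v = 0%MM by apply: (@exchange_poly_monomial_divisor c v 1); rewrite mulr1.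
apply: P_not_invertible; rewrite -ev_exchange_poly e v0 mpolyX0 mulr1 evC.
split; first exact: KP_scalar.
exists (@Defs.scalar K m n c^-1); first exact: KP_scalar.
by rewrite -!(evC t) -rmorphM -mpolyCM divrr // rmorph1.
Qed.

Lemma clusterE : A = P * A'^-1.
Proof.
by rewrite cluster_mut invfM invrK mulrCA mulfV ?mulr1 // exchange_binomial_neq0.
Qed.

Lemma laurent_mut_exchange_binomial : laurent t' P.
Proof. by rewrite -ev_mut_exchange_poly; apply: laurent_ev. Qed.

Lemma laurent_mut_cluster_mutV : laurent t' A'^-1.
Proof. by rewrite -vars_r; apply: laurent_varsV. Qed.

Lemma laurent_mut_cluster_mut : laurent t' A'.
Proof. by rewrite -vars_r; apply: laurent_vars. Qed.

Lemma laurent_mut_cluster : laurent t' A.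
Proof.
rewrite clusterE; apply: (subringM subL'); first exact: laurent_mut_exchange_binomial.
exact: laurent_mut_cluster_mutV.
Qed.

Lemma cluster_inv_not_laurent_mut : ~ laurent t' A^-1.
Proof.
move=> LA; apply: exchange_binomial_nonunit; split; first exact: laurent_mut_exchange_binomial.
exists (A^-1 * A'^-1).
  by apply: (subringM subL') => //; exact: laurent_mut_cluster_mutV.
by rewrite mulrCA -clusterE mulVf // cluster_neq0.
Qed.

Lemma poly_omit_subring : subring (poly_omit t k). Proof. exact: subring_genP. Qed.

Lemma poly_omit_zap p : poly_omit t k (ev t (zap kk p)).
Proof.
have sub := poly_omit_subring.
elim/mpoly_gen_ind: p => [c|i|p q Sp Sq|p q Sp Sq].
- by rewrite zapC evC; apply: subring_gen_in; apply: Or31; exists c.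
- rewrite zapX; case: eqP => [_|/eqP]; first by rewrite rmorph0; apply: (subring0 sub).
  rewrite evX; elim/ord_split_ind: i => [a _|j].
    by rewrite vars_l; apply: subring_gen_in; apply: Or32; exists a.
  by rewrite eq_rshift vars_r => jk; apply: subring_gen_in; apply: Or33; exists j.
- by rewrite !rmorphD; apply: (subringD sub).
- by rewrite !rmorphM; apply: (subringM sub).
Qed.

Lemma poly_omitP f : poly_omit t k f -> exists2 p, zap kk p = p & f = ev t p.
Proof.
apply: (subring_gen_min (S := fun f => exists2 p, zap kk p = p & f = ev t p)).
  split=> [|_ _ [p zp ->] [q zq ->]|_ _ [p zp ->] [q zq ->]].
  - by exists 1; rewrite rmorph1.
  - by exists (p - q); rewrite rmorphB ?zp ?zq.
  - by exists (p * q); rewrite rmorphM ?zp ?zq.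
move=> x [[c ->]|[i ->]|[j jk ->]].
- by exists c%:MP; rewrite ?zapC ?evC.
- exists 'X_(lshift n i); last by rewrite evX vars_l.
  by rewrite zapX eq_lrshift.
- exists 'X_(rshift m j); last by rewrite evX vars_r.
  by rewrite zapX eq_rshift (negbTE jk).
Qed.

End ExchangePolynomial.

(** * The equivalences *)

(** Degrees in ['X_i] add up under multiplication. The morphism [s] reads a polynomial as a
    univariate one in ['X_i], and [s y], [s z] must then be constant. *)
Lemma zap_factor (R : idomainType) (N : nat) (i : 'I_N) (y z b : {mpoly R[N]}) :
  y * z = b -> b != 0 -> zap i b = b -> zap i y = y.
Proof.
move=> e b0 zb.
have [s [sC sX]] := mpoly_rmorph_ex (polyC \o @mpolyC N R)
  (fun j => if j == i then 'X else ('X_j)%:P).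
have sz p : s (zap i p) = (zap i p)%:P.
  apply: (mpoly_rmorph_eq (f := s \o zap i) (g := polyC \o zap i) _ _ p) => [c|j] /=.
    by rewrite zapC sC.
  rewrite zapX; case E : (j == i); first by rewrite !rmorph0.
  by rewrite sX E.
have s0 p : (s p).[0] = zap i p.
  apply: (mpoly_rmorph_eq (f := horner_eval 0 \o s) (g := zap i) _ _ p) => [c|j] /=.
    by rewrite sC /= horner_evalE hornerC zapC.
  by rewrite sX zapX horner_evalE; case: eqP => _; rewrite ?hornerX ?hornerC.
have sXi p : (s p).['X_i] = p.
  apply: (mpoly_rmorph_eq (f := horner_eval 'X_i \o s) (g := idfun) _ _ p) => [c|j] /=.
    by rewrite sC /= horner_evalE hornerC.
  by rewrite sX horner_evalE; case: eqP => [->|_]; rewrite ?hornerX ?hornerC.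
have sb : s y * s z = b%:P by rewrite -rmorphM e -zb sz.
have bP : b%:P != 0 by rewrite polyC_eq0.
have y0 : s y != 0 by apply: contraNneq bP => y0; rewrite -sb y0 mul0r.
have z0 : s z != 0 by apply: contraNneq bP => z0; rewrite -sb z0 mulr0.
have := size_mul y0 z0; rewrite sb size_polyC b0 /= => es.
have /size_poly1P[c _ ec] : size (s y) == 1%N.
  by move: y0 z0 es; rewrite -!size_poly_gt0; move: (size (s y)) (size (s z)) => a d; lia.
by rewrite -s0 -{2}[y]sXi ec !hornerC.
Qed.

Lemma max_natinf_Some (E : nat -> Prop) s :
  E s -> (forall s', E s' -> (s' <= s)%N) -> max_natinf E = Some s.
Proof.
move=> Es ub; rewrite /max_natinf; case: excluded_middle_informative => [ex|[]].
  case: constructive_indefinite_description => s' /= [Es' ub'].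
  by congr Some; apply/eqP; rewrite eqn_leq ub // ub'.
by exists s.
Qed.

Section Main.
Variables (K : idomainType) (m n : nat) (Sigma : tree_vertex n -> preseed K m n).
Variable t0 : tree_vertex n.
Hypothesis K_factorial : factorial_domain K.
Hypothesis pattern : seed_pattern Sigma.
Hypothesis not_invertible : forall (t : tree_vertex n) (k : 'I_n),
  ~ unit_in (@KP K m n) (exchange_binomial (Sigma t) k).
Hypothesis rank0 : full_rank (Sigma t0).
Local Notation F := (ambient K m n).
Local Notation U := (upper_cluster_algebra Sigma).
Local Notation t := (Sigma t0).
Local Notation mu k := (mutation k t).
Local Notation A := (cluster t).
Local Notation P := (exchange_binomial t).
Implicit Types (f x y z M : F) (k j : 'I_n).

Let free_t : free_generating (cluster t). Proof. by case: pattern => /(_ t0)[]. Qed.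
Let skew_t : skew_symmetrizable (exmx t). Proof. by case: pattern => /(_ t0)[]. Qed.
Let free_mu k : free_generating (cluster (mu k)).
Proof.
have [t' e] := tree_neighbor k t0; have [fr mut] := pattern.
by rewrite -(mut _ _ _ e); case: (fr t').
Qed.
Let UP := upper_cluster_algebraP pattern rank0.
Let nonunit k := exchange_binomial_nonunit (free_mu k) skew_t (@not_invertible t0 k).
Let A0 k := cluster_neq0 k free_t.
Let P0 k := exchange_binomial_neq0 (free_mu k).
Let AE k := clusterE (free_mu k).
Let subL := laurent_subring t.
Let subL' k := laurent_subring (mu k).

Lemma upper_subring : subring U.
Proof.
split=> [t'|x y Ux Uy t'|x y Ux Uy t'].
- exact: (subring1 (laurent_subring _)).
- exact: (subringB (laurent_subring _)).
- exact: (subringM (laurent_subring _)).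
Qed.
Let subU := upper_subring.

Lemma upper_laurent f : U f -> laurent t f. Proof. by case/UP. Qed.
Lemma upper_laurent_mu k f : U f -> laurent (mu k) f. Proof. by case/UP. Qed.

Lemma upper_KP f : @KP K m n f -> U f.
Proof. by move=> Kf t'; apply: laurent_KP. Qed.

Lemma laurent_mu_cluster j k : j != k ->
  laurent (mu j) (A k) /\ laurent (mu j) (A k)^-1.
Proof.
move=> jk; have e : A k = vars (mu j) (rshift m k).
  by rewrite vars_mut ?vars_r // eq_rshift eq_sym.
by rewrite e; split; [apply: laurent_vars | apply: laurent_varsV].
Qed.

Lemma upper_cluster k : U (A k).
Proof.
apply/UP; split=> [|j]; first by rewrite -vars_r; apply: laurent_vars.
have [->|jk] := eqVneq j k; last by case: (laurent_mu_cluster jk).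
exact: laurent_mut_cluster.
Qed.

Lemma upper_vars i : U (vars t i).
Proof.
elim/ord_split_ind: i => [a|j].
  by rewrite vars_l; apply/upper_KP/KP_coefvar.
by rewrite vars_r; apply: upper_cluster.
Qed.

Lemma upper_ev p : U (ev t p).
Proof.
by apply: (ev_subring subU) => [c|]; [apply/upper_KP/KP_scalar | apply: upper_vars].
Qed.

(** [A k] is a unit of [L(t)] and of [L(mu j)] for [j != k], so by the starfish criterion only
    [L(mu k)] constrains [y / A k]. There [A k] is [P k] times a unit. *)
Lemma cluster_dvd_exchange k y : U y ->
  divides_in U (A k) y <-> divides_in (laurent (mu k)) (P k) y.
Proof.
move=> Uy; split=> -[z Sz e].
  exists ((cluster (mu k) k)^-1 * z); last by rewrite e {1}AE mulrA.
  by apply: (subringM (subL' k)); [apply: laurent_mut_cluster_mutV | apply: upper_laurent_mu].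
exists ((A k)^-1 * y); last by rewrite mulVKf.
apply/UP; split=> [|j].
  by apply: (subringM subL); [rewrite -vars_r; apply: laurent_varsV | apply: upper_laurent].
have [->|jk] := eqVneq j k; last first.
  by apply: (subringM (subL' j)); [case: (laurent_mu_cluster jk) | apply: upper_laurent_mu].
rewrite e mulrA -cluster_mut.
by apply: (subringM (subL' k)) => //; apply: laurent_mut_cluster_mut.
Qed.

Lemma divides_cluster k y : divides_in U (A k) y <-> U (y / A k).
Proof.
split=> [[z Uz ->]|Uy]; first by rewrite mulrC mulKf.
by exists (y / A k); rewrite // mulrC divfK.
Qed.

Lemma cluster_inv_not_laurent k : ~ laurent (mu k) (A k)^-1.
Proof. exact: (cluster_inv_not_laurent_mut free_t (free_mu k) skew_t (@not_invertible t0 k)). Qed.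

Lemma cluster_nonunit k : ~ unit_in U (A k).
Proof.
case=> _ [y Uy Ay]; apply: (@cluster_inv_not_laurent k).
by rewrite -[_^-1]mulr1 -Ay mulKf //; apply: upper_laurent_mu.
Qed.

Lemma mu_factorable k f : laurent (mu k) f -> f <> 0 ->
  prime_factorable (laurent (mu k)) f.
Proof. exact: laurent_prime_factorable. Qed.

Lemma cluster_power_bound k M : U M -> M <> 0 -> exists N, ~ U (M / A k ^+ N).
Proof.
move=> UM M0; have LM := upper_laurent_mu k UM.
have LP : laurent (mu k) (P k) by apply: (laurent_mut_exchange_binomial k skew_t).
have [N ND] := prime_factorable_bound (subL' k) LP (nonunit (k := k)) (mu_factorable LM M0).
exists N => UMA; apply: ND; exists (M / A k ^+ N * (cluster (mu k) k)^-1 ^+ N).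
  apply: (subringM (subL' k)); first exact: upper_laurent_mu.
  by apply: (subringX (subL' k)); apply: laurent_mut_cluster_mutV.
by rewrite mulrCA -exprMn -AE divfK // expf_neq0.
Qed.

Lemma cluster_multiplicity k M : U M -> M <> 0 ->
  exists s, U (M / A k ^+ s) /\ ~ U (M / A k ^+ s.+1).
Proof.
move=> UM M0; have [N] := cluster_power_bound k UM M0.
elim: N => [|N IHN]; first by rewrite expr0 divr1.
by have [h|/IHN //] := classic (U (M / A k ^+ N)); exists N.
Qed.

Lemma upper_div_pow k M s s' : (s' <= s)%N -> U (M / A k ^+ s) -> U (M / A k ^+ s').
Proof.
move=> le; rewrite -(subnKC le) exprD invfM mulrA => h.
rewrite -[M / _](divfK (expf_neq0 (s - s') (A0 k))).
by apply: (subringM subU) => //; apply: (subringX subU); apply: upper_cluster.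
Qed.

Lemma val_pairing_multiplicity k M s : U (M / A k ^+ s) -> ~ U (M / A k ^+ s.+1) ->
  val_pairing U (A k) M = Some s.
Proof.
move=> Us Ns; apply: max_natinf_Some => // s' Us'; rewrite leqNgt; apply/negP => lt.
exact/Ns/(upper_div_pow lt).
Qed.

Lemma prime_cluster_val k : prime_in U (A k) -> forall M L, U M -> U L ->
  M <> 0 -> L <> 0 ->
  val_pairing U (A k) (M * L) = addni (val_pairing U (A k) M) (val_pairing U (A k) L).
Proof.
case=> _ _ _ pA M L UM UL M0 L0.
have [a [Ua Na]] := cluster_multiplicity k UM M0.
have [b [Ub Nb]] := cluster_multiplicity k UL L0.
rewrite (val_pairing_multiplicity Ua Na) (val_pairing_multiplicity Ub Nb).
have e : M * L / A k ^+ (a + b) = (M / A k ^+ a) * (L / A k ^+ b).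
  by rewrite exprD invfM mulrACA.
apply: val_pairing_multiplicity; first by rewrite e; apply: (subringM subU).
rewrite exprSr invfM mulrA e => /divides_cluster/(pA _ _ Ua Ub)[] /divides_cluster.
  by rewrite -mulrA -invfM -exprSr; apply: Na.
by rewrite -mulrA -invfM -exprSr; apply: Nb.
Qed.

Lemma val_prime_cluster k :
  (forall M L, U M -> U L -> M <> 0 -> L <> 0 ->
     val_pairing U (A k) (M * L)
     = addni (val_pairing U (A k) M) (val_pairing U (A k) L)) ->
  prime_in U (A k).
Proof.
move=> val; split; [exact: upper_cluster | exact/eqP/A0 | exact: cluster_nonunit |].
move=> y z Uy Uz /divides_cluster d.
have [->|/eqP y0] := eqVneq y 0.
  by left; exists 0; rewrite ?mulr0 //; apply: (subring0 subU).
have [->|/eqP z0] := eqVneq z 0.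
  by right; exists 0; rewrite ?mulr0 //; apply: (subring0 subU).
have yz0 : y * z <> 0 by move/eqP; rewrite mulf_eq0 => /orP[] /eqP.
have [a [Ua Na]] := cluster_multiplicity k Uy y0.
have [b [Ub Nb]] := cluster_multiplicity k Uz z0.
have [c [Uc Nc]] := cluster_multiplicity k (subringM subU Uy Uz) yz0.
have := val y z Uy Uz y0 z0.
rewrite (val_pairing_multiplicity Ua Na) (val_pairing_multiplicity Ub Nb).
rewrite (val_pairing_multiplicity Uc Nc) => -[ec].
have c0 : (0 < c)%N.
  by rewrite lt0n; apply/eqP => c0; apply: Nc; rewrite c0 expr1.
have [a0|b0] : (0 < a \/ 0 < b)%N by lia.
  by left; apply/divides_cluster; have := upper_div_pow a0 Ua; rewrite expr1.
by right; apply/divides_cluster; have := upper_div_pow b0 Ub; rewrite expr1.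
Qed.

(** If [P k = y * z], then [A k] divides one factor in [U], hence so does [P k] in [L(mu k)], and
    the other is a unit there: a scalar times a monomial. No variable divides [P k], so only the
    scalar is left. *)
Lemma prime_cluster_irreducible k : prime_in U (A k) ->
  irreducible_in (poly_omit t k) (P k).
Proof.
case=> _ _ _ pA.
have omitU f : poly_omit t k f -> U f by case/poly_omitP => p _ ->; apply: upper_ev.
have zP := zap_exchange_poly k skew_t; have evP := ev_exchange_poly t k.
split.
- by rewrite -evP -zP; apply: poly_omit_zap.
- exact/eqP/P0.
- move=> [/omitU/(@upper_laurent_mu k) LP [y /omitU/(@upper_laurent_mu k) Ly Py]].
  by apply: (nonunit (k := k)); split=> //; exists y.
have key y z : poly_omit t k y -> poly_omit t k z -> P k = y * z ->
    divides_in U (A k) y -> unit_in (poly_omit t k) z.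
  move=> Sy Sz e; have [Uy Uz] := (omitU y Sy, omitU z Sz).
  case/(cluster_dvd_exchange k Uy) => w Lw ey.
  have wz : z * w = 1.
    by apply: (mulfI (P0 k)); rewrite mulr1 [z * w]mulrC mulrA -ey.
  have uz : unit_in (laurent (mu k)) z.
    by split; [apply: upper_laurent_mu | exists w].
  have [p zp ep] := poly_omitP Sy; have [g zg eg] := poly_omitP Sz.
  have eg' : z = ev (mu k) g by rewrite eg -zg; apply: ev_zap.
  rewrite eg' in uz; have [c [v [uc ec]]] := ev_unit (free_mu k) uz.
  have v0 : v = 0%MM.
    apply: (exchange_poly_monomial_divisor (free_mu k) (c := c) (g := p)).
    by rewrite -ec mulrC; apply: (ev_inj free_t); rewrite rmorphM -ep -eg -e evP.
  rewrite v0 mpolyX0 mulr1 in ec; rewrite eg ec evC.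
  have Sc (d : K) : poly_omit t k (@Defs.scalar K m n d).
    by apply: subring_gen_in; apply: Or31; exists d.
  split=> //; exists (@Defs.scalar K m n c^-1) => //.
  by rewrite -!(evC t) -rmorphM -mpolyCM divrr // rmorph1.
move=> y z Sy Sz e.
have dP : divides_in U (A k) (y * z).
  apply/cluster_dvd_exchange; first by apply: (subringM subU); apply: omitU.
  by rewrite -e; exists 1; rewrite ?mulr1 //; apply: (subring1 (subL' k)).
case: (pA y z (omitU y Sy) (omitU z Sz) dP) => d; first by right; apply: key d.
by left; apply: key d => //; rewrite mulrC.
Qed.

Lemma mpoly_factorable (p : {mpoly K[m + n]}) : p <> 0 ->
  prime_factorable (@everything {mpoly K[m + n]}) p.
Proof.
by apply: mpoly_prime_factorable => x x0; apply: factorial_prime_factorable.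
Qed.

(** Polynomial factors of [exchange_poly] are free of the omitted variable, so irreducibility
    extends to all [m + n] variables, where it gives primality; this survives localization because
    [P k] is not a unit of [L(mu k)]. *)
Lemma irreducible_prime_cluster k : irreducible_in (poly_omit t k) (P k) ->
  prime_in U (A k).
Proof.
move=> [_ _ _ irr]; have zP := zap_exchange_poly k skew_t.
have evP := ev_exchange_poly t k.
have b0 : exchange_poly t k != 0.
  by apply: contraNneq (P0 k) => b0; rewrite -evP b0 rmorph0.
have irrW : irreducible_in (@everything _) (exchange_poly t k).
  split=> //; first exact/eqP.
    case=> _ [q _ e]; apply: (nonunit (k := k)); split.
      exact: (laurent_mut_exchange_binomial k skew_t).
    exists (ev (mu k) q); first exact: laurent_ev.
    by rewrite -(ev_mut_exchange_poly k skew_t) -rmorphM e rmorph1.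
  move=> y z _ _ e; have zy := zap_factor (esym e) b0 zP.
  have zz : zap (rshift m k) z = z.
    by apply: (zap_factor _ b0 zP); rewrite mulrC; apply: esym e.
  have unitW q : unit_in (poly_omit t k) (ev t q) -> unit_in (@everything _) q.
    case=> _ [w /poly_omitP[w' _ ->]]; rewrite -rmorphM -(rmorph1 (ev t)).
    by move/(ev_inj free_t) => qw; split=> //; exists w'.
  case: (irr (ev t y) (ev t z)) => [|||/unitW|/unitW]; [| | |by left|by right].
  - by rewrite -zy; apply: poly_omit_zap.
  - by rewrite -zz; apply: poly_omit_zap.
  - by rewrite -evP e rmorphM.
have pW : prime_in (@everything _) (exchange_poly t k).
  by apply: irreducible_prime irrW => //; apply: mpoly_factorable; apply/eqP.
have pP : prime_in (laurent (mu k)) (P k).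
  rewrite -(ev_mut_exchange_poly k skew_t); case: (ev_prime (free_mu k) pW) => // u.
  by case: (nonunit (k := k)); rewrite -(ev_mut_exchange_poly k skew_t).
split; [exact: upper_cluster | exact/eqP/A0 | exact: cluster_nonunit |].
move=> y z Uy Uz /(cluster_dvd_exchange k (subringM subU Uy Uz)); case: pP => _ _ _ pP.
case/pP; try exact: upper_laurent_mu.
  by move/(cluster_dvd_exchange k Uy); left.
by move/(cluster_dvd_exchange k Uz); right.
Qed.

Lemma scalar_unit_upper c : c \is a GRing.unit -> unit_in U (@Defs.scalar K m n c).
Proof.
move=> uc; split; first by apply/upper_KP/KP_scalar.
exists (@Defs.scalar K m n c^-1); first by apply/upper_KP/KP_scalar.
by rewrite -!(evC t) -rmorphM -mpolyCM divrr // rmorph1.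
Qed.

Lemma mon_upper (e : 'I_(m + n) -> int) :
  (forall j, 0 <= e (rshift m j)) -> U (mon t e).
Proof.
move=> e0; rewrite /mon big_split_ord; apply: (subringM subU).
  have -> : \prod_(a < m) vars t (lshift n a) ^ e (lshift n a)
      = trop_mon K n (\row_a e (lshift n a)).
    by apply: eq_bigr => a _; rewrite vars_l mxE.
  exact/upper_KP/KP_trop_mon.
apply: (subring_prod subU) => j _; case: (e _) (e0 j) => // a _.
exact/(subringX subU)/upper_vars.
Qed.

Lemma mon_unit_upper (e : 'I_(m + n) -> int) :
  (forall j, e (rshift m j) = 0) -> unit_in U (mon t e).
Proof.
move=> e0; split; first by apply: mon_upper => j; rewrite e0.
exists (mon t (fun i => - e i)); first by apply: mon_upper => j; rewrite e0.
by rewrite monN // divff // mon_neq0.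
Qed.

(** A negative exponent of [A j] would bring the inverse of [A j] into [L(mu j)], where the other
    variables of [t] are units. *)
Lemma upper_unit_mon u (e : 'I_(m + n) -> int) : unit_in U u -> U (u * mon t e) ->
  forall j, 0 <= e (rshift m j).
Proof.
move=> uu Ue j; rewrite leNgt; apply/negP => ej; pose i : 'I_(m + n) := rshift m j.
have [v uv uv1] := unit_in_inv uu.
have L1 : laurent (mu j) (mon t e).
  apply: upper_laurent_mu; rewrite -[mon t e]mul1r -uv1 [u * v]mulrC -mulrA.
  by apply: (subringM subU) => //; case: uv.
have L2 : laurent (mu j) (vars t i ^ e i).
  pose e' (x : 'I_(m + n)) := if x == i then 0 else e x.
  have -> : vars t i ^ e i = mon t e * mon (mu j) (fun i => - e' i).
    rewrite monN // mon_mut0; last by rewrite /e' eqxx.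
    by rewrite [mon t e](mon_split_seed _ _ i) [_ * vars t i ^ _]mulrC mulfK // mon_neq0.
  by apply: (subringM (subL' j)) => //; apply: laurent_mon.
apply: (@cluster_inv_not_laurent j).
have -> : (A j)^-1 = vars t i ^ e i * A j ^+ (absz (e i)).-1.
  rewrite vars_r exprnP -expfzDr // -exprN1; congr (_ ^ _).
  by move: ej; rewrite -/i; lia.
by apply: (subringM (subL' j)) => //; apply/(subringX (subL' j))/upper_laurent_mu/upper_cluster.
Qed.

(** The factors of [A k] are units of [L(t)], hence scalar units times monomials. Their cluster
    exponents are non-negative and add up to those of [A k], so one factor involves no cluster
    variable. *)
Lemma cluster_irreducible k : irreducible_in U (A k).
Proof.
split; [exact: upper_cluster | exact/eqP/A0 | exact: cluster_nonunit |].
move=> y z Uy Uz eA.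
have uy : unit_in (laurent t) y.
  split; first exact: upper_laurent.
  exists (z * (A k)^-1); last by rewrite mulrA -eA divff.
  by apply: (subringM subL); [apply: upper_laurent | rewrite -vars_r; apply: laurent_varsV].
have [c [e [uc ey]]] := laurent_unitP free_t uy.
have us := scalar_unit_upper uc; have [c' uc' cc'] := unit_in_inv us.
pose d (i : 'I_(m + n)) : int := if i == rshift m k then 1 else 0.
have ez : z = c' * mon t (fun i => d i + - e i).
  rewrite monD // mon_vars expr1z vars_r eA ey monN //.
  rewrite [RHS](_ : _ = @Defs.scalar K m n c * c' * (mon t e / mon t e) * z); last by ring.
  by rewrite cc' divff ?mul1r // mon_neq0.
have Ue : U (@Defs.scalar K m n c * mon t e) by rewrite -ey.
have e0 := upper_unit_mon us Ue.
have Ud : U (c' * mon t (fun i => d i + - e i)) by rewrite -ez.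
have d0 := upper_unit_mon uc' Ud.
have dE j : d (rshift m j) = if j == k then 1 else 0 by rewrite /d eq_rshift.
have [ek|ek] : e (rshift m k) = 0 \/ e (rshift m k) = 1.
  by have := e0 k; have := d0 k; rewrite dE eqxx; lia.
- left; rewrite ey; apply: (unit_inM subU us); apply: mon_unit_upper => j.
  by have := e0 j; have := d0 j; rewrite dE; case: eqP => [->|_]; lia.
- right; rewrite ez; apply: (unit_inM subU uc'); apply: mon_unit_upper => j.
  by have := e0 j; have := d0 j; rewrite dE; case: eqP => [->|_]; rewrite ?ek; lia.
Qed.

(** * Nagata's argument *)

Section Nagata.
Hypothesis prime_A : forall k, prime_in U (A k).
Implicit Types s : seq 'I_n.

Definition cluster_monomial s := \prod_(j <- s) A j.

Lemma clear_cluster_denominator f : laurent t f -> exists s, U (f * cluster_monomial s).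
Proof.
have mon_U s : U (cluster_monomial s).
  by apply: (subring_prod subU) => j _; apply: upper_cluster.
apply: (subring_gen_min (S := fun f => exists s, U (f * cluster_monomial s))).
  split=> [|x y [s Us] [s' Us']|x y [s Us] [s' Us']].
  - by exists [::]; rewrite mul1r; apply: mon_U.
  - exists (s ++ s'); rewrite /cluster_monomial big_cat.
    rewrite [_ * (_ * _)](_ : _ = x * cluster_monomial s * cluster_monomial s'
      - y * cluster_monomial s' * cluster_monomial s); last by rewrite /cluster_monomial /=; ring.
    by apply: (subringB subU); apply: (subringM subU).
  - exists (s ++ s'); rewrite /cluster_monomial big_cat mulrACA.
    exact: (subringM subU).
move=> x [Kx|[j ->]|[j ->]].
- by exists [::]; rewrite /cluster_monomial big_nil mulr1; apply: upper_KP.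
- by exists [::]; rewrite /cluster_monomial big_nil mulr1; apply: upper_cluster.
- exists [:: j]; rewrite /cluster_monomial big_seq1 mulVf //.
  exact: (subring1 subU).
Qed.

(** Some cluster monomial times [w] lies in [U]. Its factors [A j] can be removed one by one: [A j]
    divides [q] times that product, but not [q]. *)
Lemma cancel_cluster_free q w : U q -> (forall j, ~ divides_in U (A j) q) ->
  laurent t w -> U (q * w) -> U w.
Proof.
move=> Uq qA Lw Uqw; have [s] := clear_cluster_denominator Lw.
elim: s => [|j s IHs]; first by rewrite /cluster_monomial big_nil mulr1.
rewrite /cluster_monomial big_cons -/(cluster_monomial s) mulrCA => Uw; apply: IHs.
have Us : U (cluster_monomial s).
  by apply: (subring_prod subU) => i _; apply: upper_cluster.
have [_ _ _ pA] := prime_A j.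
case: (pA q (A j * (w * cluster_monomial s)) Uq Uw).
- exists (q * w * cluster_monomial s); first exact: (subringM subU).
  by ring.
- by move/qA.
- by case=> z Uz /(mulfI (A0 j)) ->.
Qed.

(** After a cluster monomial has moved [f] into [U], the full power of each [A j] is divided out in
    turn. The quotient divides the previous element, so variables already treated do not
    reappear. *)
Lemma strip_clusters f : laurent t f -> f <> 0 ->
  exists2 v, unit_in (laurent t) v & U (f * v) /\ forall j, ~ divides_in U (A j) (f * v).
Proof.
move=> Lf f0; have [s Us] := clear_cluster_denominator Lf.
have unitA j : unit_in (laurent t) (A j).
  rewrite -vars_r; split; first exact: laurent_vars.
  by exists (vars t (rshift m j))^-1; [apply: laurent_varsV | rewrite divff // vars_neq0].
have us : unit_in (laurent t) (cluster_monomial s).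
  apply: (big_ind (unit_in (laurent t))) => [||j _]; last exact: unitA.
    exact: (unit_in1 subL).
  exact: (unit_inM subL).
suff H (r : seq 'I_n) : exists2 v, unit_in (laurent t) v &
    U (f * v) /\ forall j, j \in r -> ~ divides_in U (A j) (f * v).
  have [v uv [Uv nv]] := H (enum 'I_n); exists v => //; split=> // j.
  by apply: nv; rewrite mem_enum.
elim: r => [|j r [v uv [Uv nv]]]; first by exists (cluster_monomial s).
have fv0 : f * v <> 0.
  move/eqP; rewrite mulf_eq0 => /orP[/eqP //|/eqP]; exact: unit_in_neq0 uv.
have [a [Ua Na]] := cluster_multiplicity j Uv fv0.
have uAa : unit_in (laurent t) (A j ^+ a)^-1.
  have uX : unit_in (laurent t) (A j ^+ a).
    elim: a {Ua Na} => [|a IHa]; first by rewrite expr0; apply: (unit_in1 subL).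
    by rewrite exprS; apply: (unit_inM subL).
  have [w uw e] := unit_in_inv uX.
  by have -> : (A j ^+ a)^-1 = w by rewrite -[LHS]mulr1 -e mulKf // expf_neq0.
exists (v * (A j ^+ a)^-1); first exact: (unit_inM subL).
rewrite mulrA; split=> // i; rewrite in_cons => /orP[/eqP ->|ir] d.
  by apply: Na; move/divides_cluster: d; rewrite -mulrA -invfM -exprSr.
apply: (nv i ir); rewrite -[f * v](divfK (expf_neq0 a (A0 j))).
apply: (divides_in_mulr subU) d; apply: (subringX subU); exact: upper_cluster.
Qed.

(** By [cancel_cluster_free], a quotient by [q] in [L(t)] of an element of [U] already lies in [U],
    so both rings agree on divisibility by [q]. *)
Lemma cluster_free_prime q : U q -> (forall j, ~ divides_in U (A j) q) ->
  prime_in (laurent t) q -> prime_in U q.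
Proof.
move=> Uq qA [_ q0 qN qp]; split=> //.
  by case=> _ [y Uy e]; apply: qN; split; [|exists y]; try exact: upper_laurent.
have key y : U y -> divides_in (laurent t) q y -> divides_in U q y.
  move=> Uy [w Lw e]; exists w => //.
  by apply: (cancel_cluster_free Uq qA Lw); rewrite -e.
move=> y z Uy Uz [w Uw e].
have : divides_in (laurent t) q (y * z) by exists w => //; apply: upper_laurent.
case/qp; try exact: upper_laurent.
  by move/(key _ Uy); left.
by move/(key _ Uz); right.
Qed.

Lemma upper_prime_factorable x : U x -> x <> 0 -> prime_factorable U x.
Proof.
move=> Ux x0.
have [u [qs [uu pq e]]] :=
  laurent_prime_factorable free_t K_factorial (upper_laurent Ux) x0.
elim: qs u x Ux x0 uu pq e => [|q qs IHq] u x Ux x0 uu pq e.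
  (* Here [x] is a unit of [L(t)]. Clearing the denominator of its inverse shows that [x] divides a
     product of the primes [A j] in [U]. *)
  rewrite big_nil mulr1 in e; rewrite -e in uu; case: uu => _ [y Ly xy].
  have [s Us] := clear_cluster_denominator Ly.
  apply: (prime_factorable_divisor subU Ux Us); rewrite mulrA xy mul1r.
  apply: (big_ind (prime_factorable U)) => [||j _].
  - exact/prime_factorable_unit/(unit_in1 subU).
  - exact: (prime_factorableM subU).
  - exact: (prime_factorable_prime subU).
have pqq := pq q (mem_head _ _); have [Lq q0 _ _] := pqq.
have [v uv [Uqv nqv]] := strip_clusters Lq q0.
have [v' uv' vv'] := unit_in_inv uv.
(* The prime [q] is replaced by its associate [q * v], which lies in [U] and is prime there; the
   cofactor [w] absorbs the inverse unit and has one prime fewer. *)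
pose w := u * v' * \prod_(r <- qs) r.
have pqs r : r \in qs -> prime_in (laurent t) r.
  by move=> rq; apply: pq; rewrite in_cons rq orbT.
have uw : unit_in (laurent t) (u * v') by apply: (unit_inM subL).
have Lw : laurent t w.
  apply: (subringM subL); first by case: uw.
  by apply: (Sprod subL) => r /pqs [].
have ex : x = q * v * w.
  rewrite e big_cons /w; move: (\prod_(r <- qs) r) => Q.
  transitivity (v * v' * (u * (q * Q))); first by rewrite vv' mul1r.
  by ring.
have Uw : U w by apply: (cancel_cluster_free Uqv nqv Lw); rewrite -ex.
rewrite ex; apply: (prime_factorableM subU).
  apply: (prime_factorable_prime subU); apply: cluster_free_prime => //.
  exact: (prime_in_unit_mul subL).
apply: (IHq (u * v')) => // w0; apply: x0; by rewrite ex w0 mulr0.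
Qed.

End Nagata.

End Main.

Theorem theorem4p9 (K : idomainType) (m n : nat)
    (Sigma : tree_vertex n -> preseed K m n) (t0 : tree_vertex n)
    (K_factorial : factorial_domain K)
    (K_char0 : [pchar K] =i pred0)
    (Sigma_pattern : seed_pattern Sigma)
    (binomials_not_invertible : forall (t : tree_vertex n) (k : 'I_n),
       ~ unit_in (@KP K m n) (exchange_binomial (Sigma t) k))
    (Sigma_full_rank : full_rank (Sigma t0)) :
  let U := upper_cluster_algebra Sigma in
  let A := cluster (Sigma t0) in
  [<-> factorial_in U;
       forall k : 'I_n, prime_in U (A k);
       forall (k : 'I_n) (M L : ambient K m n),
         U M -> U L -> M <> 0 -> L <> 0 ->
         val_pairing U (A k) (M * L)
         = addni (val_pairing U (A k) M) (val_pairing U (A k) L);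
       forall k : 'I_n,
         irreducible_in (poly_omit (Sigma t0) k)
           (exchange_binomial (Sigma t0) k)].
Proof.
move=> U A.
have subU : subring U by apply: upper_subring.
tfae.
- move=> fU k; apply: (factorial_irreducible_prime subU fU).
  exact: (cluster_irreducible Sigma_pattern binomials_not_invertible Sigma_full_rank).
- move=> pA k M L.
  exact: (prime_cluster_val K_factorial Sigma_pattern binomials_not_invertible Sigma_full_rank).
(* Additivity gives primality of [A k] first, and irreducibility of the binomial follows from it. *)
- move=> val k.
  apply: (prime_cluster_irreducible Sigma_pattern binomials_not_invertible Sigma_full_rank).
  apply: (val_prime_cluster K_factorial Sigma_pattern binomials_not_invertible
    Sigma_full_rank) => M L; exact: val.
- move=> irr; apply: (prime_factorable_factorial subU) => x Ux x0.
  apply: (upper_prime_factorable K_factorial Sigma_pattern binomials_not_invertible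
    Sigma_full_rank) => // k.
  exact: (irreducible_prime_cluster K_factorial Sigma_pattern binomials_not_invertible).
Qed.
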